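(* Fix $1<p_0<\infty$ and $0\le\rho_0\le(1-p_0^{-1})\ln2$. Then the differential equation $$u'(t)=C\left(\rho_0(1+e^{-u(t)})\right),\qquad C(\ln2-h(y))=\frac{2-4\sqrt{y(1-y)}}{\ln2-h(y)},$$ has a unique solution on $[0,\infty)$ with $u(0)=\ln(p_0-1)$. Furthermore, for any $n\ge1$ and any $f:\{0,1\}^n\to\mathbb{R}_+$ with $\|f\|_{p_0}\ge e^{n\rho_0}\|f\|_1$ we have, for all $t\ge0$, $$\|T_t^{\otimes n}f\|_{p(t)}\le\|f\|_{p_0},\qquad p(t)=1+e^{u(t)}.$$
   Context: $h(x)=-x\ln x-(1-x)\ln(1-x)$ is the binary entropy function (natural logarithm). The function $C:[0,\ln2]\to[2,2/\ln2]$ is defined by the displayed formula with $y\in[0,1/2]$, with $C(0)=2$ by continuity (the case $y=1/2$). Norms are $\|f\|_p=(\mathbb{E}|f|^p)^{1/p}$ with respect to the uniform probability measure on $\{0,1\}^n$. $T_t$ acts on functions on $\{0,1\}$ by $T_tf(x)=f(x)\frac{1+e^{-t}}2+f(1-x)\frac{1-e^{-t}}2$, and $T_t^{\otimes n}$ is the corresponding product (tensor power) semigroup acting on functions on $\{0,1\}^n$. *)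

(* Defs.v *)
From mathcomp Require Import all_boot all_order all_algebra.
From mathcomp Require Import all_classical all_reals all_analysis.
Set Implicit Arguments.
Unset Strict Implicit.
Unset Printing Implicit Defensive.
Import Order.TTheory GRing.Theory Num.Theory.
Import numFieldNormedType.Exports.
Local Open Scope classical_set_scope.
Local Open Scope ring_scope.

(* [ln 0 = 0] in the library, so [binent 0 = binent 1 = 0]. *)
Definition binent (R : realType) (x : R) : R :=
  - (x * ln x) - (1 - x) * ln (1 - x).

(* The unique [y] in [0, 1/2] with [ln 2 - binent y = x], for [x] in
   [0, ln 2]; the default value is only reached outside of this interval. *)
Definition binent_param (R : realType) (x : R) : R :=
  xget 0 [set y : R | 0 <= y <= 2^-1 /\ ln 2 - binent y = x].

(* Meaningful on [0, ln 2] only. At [x = 0], that is [y = 1/2], the quotient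
   is 0 / 0 and the value is the limit 2. *)
Definition C_LSI (R : realType) (x : R) : R :=
  let y := binent_param x in
  if x == 0 then 2
  else (2 - 4 * Num.sqrt (y * (1 - y))) / (ln 2 - binent y).

Definition cube (n : nat) : finType := {ffun 'I_n -> bool}.

Definition expectation_cube (R : realType) (n : nat) (f : cube n -> R) : R :=
  (2 ^+ n)^-1 * \sum_(x : cube n) f x.

Definition norm_cube (R : realType) (n : nat) (p : R) (f : cube n -> R) : R :=
  (expectation_cube (fun x => `|f x| `^ p)) `^ p^-1.

Definition T_bit (R : realType) (t : R) (f : bool -> R) (x : bool) : R :=
  f x * ((1 + expR (- t)) / 2) + f (~~ x) * ((1 - expR (- t)) / 2).

(* The tensor power of a linear operator [A] on functions on {0,1}: write [f]
   in the basis of the point masses [\delta_y = \bigotimes_i \delta_(y i)] and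
   send each of them to [\bigotimes_i A \delta_(y i)]. *)
Definition tensor_power (R : realType) (n : nat)
    (A : (bool -> R) -> (bool -> R)) (f : cube n -> R) (x : cube n) : R :=
  \sum_(y : cube n)
    f y * \prod_(i < n) A (fun b => (b == y i)%:R) (x i).

(* [u] solves [u' = C (rho0 (1 + e^-u))] on [0, +oo[; the values of [u] on
   negative reals are irrelevant. The argument of [C_LSI] must lie in the domain
   of that function. At the left end point the derivative is the right one. *)
Definition ode_solution (R : realType) (rho0 : R) (u : R -> R) : Prop :=
  let rhs t := C_LSI (rho0 * (1 + expR (- u t))) in
  [/\ forall t : R, 0 <= t -> 0 <= rho0 * (1 + expR (- u t)) <= ln 2,
      forall t : R, 0 < t -> is_derive t 1 u (rhs t)
    & h^-1 * (u h - u 0) @[h --> 0^'+] --> rhs 0].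

Lemma binent_lt (R : realType) (a b : R) :
  0 <= a -> a < b -> b <= 2^-1 -> binent a < binent b.
Proof.
move=> a0 ab b2; have b0 : 0 < b by apply: le_lt_trans ab.
have half1 : (2^-1 : R) < 1 by rewrite invf_lt1// ltr1n.
have b1 : b < 1 by apply: le_lt_trans half1.
have [a_eq0|a_neq0] := eqVneq a 0.
  have -> : binent a = 0 by rewrite a_eq0 /binent mul0r subr0 ln1 mulr0 subr0 oppr0.
  have lb : ln b < 0 by rewrite ln_lt0// b0 b1.
  have lb' : ln (1 - b) < 0 by rewrite ln_lt0// subr_gt0 b1 gtrBl.
  by rewrite /binent addr_gt0// oppr_gt0 pmulr_rlt0// subr_gt0.
have {a_neq0}a_gt0 : 0 < a by rewrite lt_neqAle eq_sym a_neq0.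
have dB (x : R) : 0 < x -> x < 1 ->
    is_derive x 1 (@binent R) (ln (1 - x) - ln x).
  move=> x0 x1; have y0 : 0 < 1 - x by rewrite subr_gt0.
  have dl := is_derive1_ln x0.
  have ds : is_derive x 1 (fun z : R => 1 - z) (-1).
    by rewrite -[-1]sub0r; apply: is_deriveB.
  have dr : is_derive x 1 (fun z : R => ln (1 - z)) ((1 - x)^-1 * -1).
    exact: (@is_derive1_comp _ _ (fun z : R => 1 - z)) (is_derive1_ln y0) ds.
  have db : is_derive x 1 (- (id * @ln R) -
      ((fun z : R => 1 - z) * (fun z : R => ln (1 - z))))
    (- (x *: x^-1 + ln x *: 1) -
      ((1 - x) *: ((1 - x)^-1 * -1) + ln (1 - x) *: (- 1))).
    exact: (is_deriveB (is_deriveN (is_deriveM (is_derive_id x 1) dl))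
      (is_deriveM ds dr)).
  apply: (is_derive_eq db); rewrite /GRing.scale/= mulrA !mulfV ?gt_eqF//.
  by rewrite !mulr1 !mulrN1 -opprD addrACA subrr add0r opprB.
have [||c] := @MVT R (@binent R) (fun x => ln (1 - x) - ln x) a b ab.
- move=> c; rewrite in_itv/= => /andP[ac cb]; apply: dB.
    exact: lt_trans ac.
  exact: lt_trans b1.
- apply: derivable_within_continuous => c; rewrite in_itv/= => /andP[ac cb].
  have [] // := dB c; first exact: lt_le_trans ac.
  exact: le_lt_trans b1.
rewrite in_itv/= -[in binent _ < _]subr_gt0 => /andP[ac cb] ->.
have c0 : 0 < c by apply: lt_trans ac.
have c2 : c < 2^-1 by apply: lt_le_trans b2.
rewrite mulr_gt0 ?subr_gt0// ltr_ln ?posrE ?subr_gt0 ?(lt_trans c2)//.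
by rewrite ltrBrDr [ltRHS](splitr 1) div1r ltrD2l.
Qed.

Lemma C_LSIE (R : realType) (y : R) : 0 <= y < 2^-1 ->
  C_LSI (ln 2 - binent y) =
    (2 - 4 * Num.sqrt (y * (1 - y))) / (ln 2 - binent y).
Proof.
move=> /andP[y0 y2]; rewrite /C_LSI.
have -> : binent_param (ln 2 - binent y) = y.
  apply: xget_unique; first by split=> //=; rewrite y0 ltW.
  move=> z [/andP[z0 z2] /(congr1 (fun x => ln 2 - x))]; rewrite !subKr => E.
  by have [zy|yz|//] := ltgtP z y;
    [have := binent_lt z0 zy (ltW y2)|have := binent_lt y0 yz z2];
    rewrite E ltxx.
have h2 : binent (2^-1 : R) = ln 2.
  have e2 : 2^-1 + 2^-1 = 1 :> R by rewrite [RHS](splitr 1) div1r.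
  have e : 1 - 2^-1 = 2^-1 :> R by rewrite -[X in X - _]e2 addrK.
  by rewrite /binent e lnV ?posrE// !mulrN !opprK -mulrDl e2 mul1r.
have := binent_lt y0 y2 (lexx _).
by rewrite h2 => lt2; rewrite gt_eqF// subr_gt0.
Qed.

Lemma tensor_power_prod (R : realType) (n : nat) (t : R)
    (g : 'I_n -> bool -> R) (x : cube n) :
  tensor_power (T_bit t) (fun y : cube n => \prod_i g i (y i)) x =
    \prod_i T_bit t (g i) (x i).
Proof.
pose F i b := g i b * T_bit t (fun c => (c == b)%:R) (x i).
transitivity (\sum_(y : cube n) \prod_i F i (y i)).
  by apply: eq_bigr => y _; rewrite big_split.
rewrite -(bigA_distr_bigA F).
apply: eq_bigr => i _; rewrite big_bool /F /T_bit; case: (x i) => /=;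
by rewrite !(mul1r, mul0r, addr0, add0r) // addrC.
Qed.

(* Main.v *)
Require Import Defs.
From mathcomp Require Import all_boot all_order all_algebra.
From mathcomp Require Import all_classical all_reals all_analysis.
From mathcomp Require Import ring lra.
Import Order.TTheory GRing.Theory Num.Theory.
Import numFieldNormedType.Exports.
Local Open Scope ring_scope.
Set Implicit Arguments.
Unset Strict Implicit.
Unset Printing Implicit Defensive.

(** On one bit, the density [(2 y, 2 (1 - y))] has entropy [deficit y], its
    square root has energy [bit_energy y], and [C_LSI] is their ratio as a
    function of the entropy. The curve of these pairs is the graph of the profile
    [x |-> C_LSI x * x]. Its slope is [4 sinh (L / 2) / L] with
    [L = ln ((1 - y) / y)], so the profile is convex because [sinh x / x]
    increases ([bit_energy_tangent]). It therefore lies above its tangents, and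
    each tangent is an affine inequality between energy, entropy and mass. Affine
    inequalities pass from one bit to [n] bits ([tensorization]). The tangent at
    [rho < ln 2] gives [C_LSI rho * entropy F <= energy F] for every positive [F] on the
    cube whose entropy is at least [n rho] times its mass ([log_sobolev_cube]).

    Let [f_t] be the image of [f] at time [t] and
    [phi t = ln ||f_t||_(p t)]. Up to a positive factor, the derivative of
    [phi] is [u'] times the entropy of [f_t `^ p] minus a term that, by the
    inequality of Stroock and Varopoulos ([energy_pow_le], again the monotonicity
    of [sinh x / x]), is at least the energy of [f_t `^ p]. As long as
    [phi t >= n rho0 + ln ||f||_1], Jensen's inequality bounds the entropy of
    [f_t `^ p] from below by [n rho0 p / (p - 1)] times its mass
    ([entropy_pow_ge]), and [p / (p - 1) = 1 + exp (- u)]. With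
    [u' = C_LSI (rho0 (1 + exp (- u)))] the derivative is thus nonpositive
    wherever [phi] exceeds its initial value, which is at least
    [n rho0 + ln ||f||_1] by assumption; so [phi] never exceeds that value
    ([barrier]).

    The coefficient [C_LSI] is continuous and takes values between 2 and a finite
    bound, but it is not Lipschitz at [ln 2]. The equation is autonomous, so it is
    solved by separating variables ([separable_ode]), and uniqueness comes from
    the positivity of [C_LSI] rather than from a Lipschitz bound. Its solutions increase strictly: for [t > 0]
    the argument of [C_LSI] is below [ln 2], which excludes the end of the profile
    where the tangent is vertical. *)

(** * Pointwise derivative rules *)

Section DerivativeRules.
Variable R : realType.
Implicit Types (f g : R -> R) (x a b : R).

Lemma is_deriveD1 f g x a b : is_derive x 1 f a -> is_derive x 1 g b ->
  is_derive x 1 (fun y => f y + g y) (a + b).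
Proof. by move=> df dg; exact: is_deriveD. Qed.

Lemma is_deriveB1 f g x a b : is_derive x 1 f a -> is_derive x 1 g b ->
  is_derive x 1 (fun y => f y - g y) (a - b).
Proof. by move=> df dg; exact: is_deriveB. Qed.

Lemma is_deriveN1 f x a : is_derive x 1 f a ->
  is_derive x 1 (fun y => - f y) (- a).
Proof. by move=> df; exact: is_deriveN. Qed.

Lemma is_deriveM1 f g x a b : is_derive x 1 f a -> is_derive x 1 g b ->
  is_derive x 1 (fun y => f y * g y) (a * g x + f x * b).
Proof.
move=> df dg.
have /is_derive_eq : is_derive x 1 (fun y => f y * g y) (f x *: b + g x *: a).
  exact: is_deriveM.
by apply; rewrite /GRing.scale/= addrC [g x * a]mulrC.
Qed.

Lemma is_deriveMl1 f x a b : is_derive x 1 f a ->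
  is_derive x 1 (fun y => b * f y) (b * a).
Proof. by move=> df; exact: is_deriveZ. Qed.

Lemma is_deriveMr1 f x a b : is_derive x 1 f a ->
  is_derive x 1 (fun y => f y * b) (a * b).
Proof.
move=> df; rewrite [a * b]mulrC.
by under eq_fun do rewrite mulrC; exact: is_deriveMl1.
Qed.

Lemma is_derive_expR1 f x a : is_derive x 1 f a ->
  is_derive x 1 (fun y => expR (f y)) (expR (f x) * a).
Proof. by move=> df; exact: (is_derive1_comp (is_derive_expR (f x)) df). Qed.

Lemma is_derive_ln1 f x a : 0 < f x -> is_derive x 1 f a ->
  is_derive x 1 (fun y => ln (f y)) (a / f x).
Proof.
move=> fx df; rewrite [a / _]mulrC.
exact: (is_derive1_comp (is_derive1_ln fx) df).
Qed.

Lemma is_derive_sqrt1 f x a : 0 < f x -> is_derive x 1 f a ->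
  is_derive x 1 (fun y => Num.sqrt (f y)) (a / (2 * Num.sqrt (f x))).
Proof.
move=> fx df; rewrite [a / _]mulrC.
exact: (is_derive1_comp (is_derive1_sqrt fx) df).
Qed.

Lemma is_deriveV1 f x a : f x != 0 -> is_derive x 1 f a ->
  is_derive x 1 (fun y => (f y)^-1) (- a / f x ^+ 2).
Proof.
move=> fx df.
have /is_derive_eq : is_derive x 1 (fun y => (f y)^-1) (- (f x) ^- 2 *: a).
  exact: is_deriveV.
by apply; rewrite /GRing.scale/= mulNr mulNr mulrC.
Qed.

Lemma is_derive_sum1 (I : Type) (s : seq I) (P : pred I)
    (h : I -> R -> R) x (dh : I -> R) :
  (forall i, is_derive x 1 (h i) (dh i)) ->
  is_derive x 1 (fun y => \sum_(i <- s | P i) h i y) (\sum_(i <- s | P i) dh i).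
Proof.
move=> H; elim: s => [|i s IH].
  rewrite big_nil; under eq_fun do rewrite big_nil.
  exact: is_derive_cst.
rewrite big_cons; under eq_fun do rewrite big_cons.
by case: (P i) => //; exact: is_deriveD1.
Qed.

(** The logarithmic form of the Leibniz rule: it needs no enumeration of the
    other factors. *)
Lemma is_derive_prod1 (I : Type) (s : seq I)
    (h : I -> R -> R) x (dh : I -> R) :
  (forall i, h i x != 0) -> (forall i, is_derive x 1 (h i) (dh i)) ->
  is_derive x 1 (fun y => \prod_(i <- s) h i y)
    ((\sum_(i <- s) dh i / h i x) * \prod_(j <- s) h j x).
Proof.
move=> h0 H; elim: s => [|i s IH].
  rewrite !big_nil mul0r; under eq_fun do rewrite big_nil.
  exact: is_derive_cst.
under eq_fun do rewrite big_cons.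
have dM := is_deriveM1 (H i) IH; apply: (is_derive_eq dM).
by rewrite !big_cons [RHS]mulrDl [in RHS]mulrA divfK// [in RHS]mulrCA.
Qed.

Lemma is_derive_continuous f x a : is_derive x 1 f a -> {for x, continuous f}.
Proof. by case=> df _; exact/differentiable_continuous/derivable1_diffP. Qed.

Lemma is_derive_ge0_le f (df : R -> R) a b : a <= b ->
  {within `[a, b], continuous f}%classic ->
  (forall x, a < x < b -> is_derive x 1 f (df x)) ->
  (forall x, a < x < b -> 0 <= df x) -> f a <= f b.
Proof.
move=> ab cf hf df0; move: ab; rewrite le_eqVlt => /predU1P[->//|ab].
have hf' x : x \in `]a, b[ -> is_derive x 1 f (df x).
  by rewrite in_itv/=; exact: hf.
have [c] := MVT ab hf' cf.
rewrite in_itv/= -subr_ge0 => /df0 dc ->.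
by rewrite mulr_ge0// subr_ge0 ltW.
Qed.

Lemma is_derive_le0_ge f (df : R -> R) a b : a <= b ->
  {within `[a, b], continuous f}%classic ->
  (forall x, a < x < b -> is_derive x 1 f (df x)) ->
  (forall x, a < x < b -> df x <= 0) -> f b <= f a.
Proof.
move=> ab cf hf df0; rewrite -lerN2.
apply: (@is_derive_ge0_le (- f) (fun x => - df x)) => //.
- by move=> x; apply: cvgN; exact: cf.
- by move=> x xab; exact: is_deriveN1 (hf _ xab).
- by move=> x xab; rewrite oppr_ge0; exact: df0.
Qed.

Lemma is_derive_within f (df : R -> R) a b :
  (forall x, a <= x <= b -> is_derive x 1 f (df x)) ->
  {within `[a, b], continuous f}%classic.
Proof.
move=> H; apply: derivable_within_continuous => x; rewrite in_itv/= => /H[].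
by [].
Qed.

End DerivativeRules.

(** * The hyperbolic sine *)

Section HyperbolicSine.
Variable R : realType.
Implicit Types x y p q l : R.

Definition sinh x : R := (expR x - expR (- x)) / 2.
Definition cosh x : R := (expR x + expR (- x)) / 2.

Lemma sinh0 : sinh 0 = 0.
Proof. by rewrite /sinh oppr0 subrr mul0r. Qed.

Lemma sinhN x : sinh (- x) = - sinh x.
Proof. by rewrite /sinh opprK -mulNr opprB. Qed.

Lemma sinh_ge0 x : 0 <= x -> 0 <= sinh x.
Proof.
by move=> x0; rewrite /sinh divr_ge0// subr_ge0 ler_expR; lra.
Qed.

Lemma cosh_le x y : 0 <= x -> x <= y -> cosh x <= cosh y.
Proof.
move=> x0 xy; rewrite /cosh ler_pM2r// !expRN.
have ex : 1 <= expR x by rewrite -expR0 ler_expR.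
have exy : expR x <= expR y by rewrite ler_expR.
set a := expR x in ex exy *; set b := expR y in exy *.
have a0 : 0 < a by lra.
have b0 : 0 < b by lra.
rewrite -subr_ge0.
have -> : b + b^-1 - (a + a^-1) = (b - a) * (a * b - 1) / (a * b).
  by field; rewrite !gt_eqF.
by rewrite divr_ge0 ?mulr_ge0 ?subr_ge0// ?(ltW a0) ?(ltW b0)//; nra.
Qed.

Lemma is_derive_sinh x : is_derive x 1 sinh (cosh x).
Proof.
have d1 := is_derive_expR x.
have d2 := is_derive_expR1 (is_deriveN1 (is_derive_id x (1 : R))).
apply: (is_derive_eq (is_deriveMr1 2^-1 (is_deriveB1 d1 d2))).
by rewrite /cosh mulrN1 opprK.
Qed.

(** This is the convexity of [sinh] on [0, +oo[ together with [sinh 0 = 0]. *)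
Lemma sinh_scale l x : 0 <= l <= 1 -> 0 <= x -> sinh (l * x) <= l * sinh x.
Proof.
move=> /andP[l0 l1] x0; rewrite -subr_ge0.
pose f y := l * sinh y - sinh (l * y).
have df y : is_derive y 1 f (l * cosh y - cosh (l * y) * l).
  apply: is_deriveB1; first exact: is_deriveMl1 (is_derive_sinh y).
  have d : is_derive y 1 (fun z : R => l * z) l.
    by apply: (is_derive_eq (is_deriveMl1 l (is_derive_id y (1 : R)))); rewrite mulr1.
  exact: (is_derive1_comp (is_derive_sinh (l * y)) d).
have <- : f 0 = 0 by rewrite /f !(mulr0, sinh0) subr0.
apply: (is_derive_ge0_le x0 (is_derive_within (fun y _ => df y)) (fun y _ => df y)).
move=> y /andP[y0 _]; rewrite [X in _ - X]mulrC -mulrBr mulr_ge0// subr_ge0.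
by rewrite cosh_le ?mulr_ge0 ?(ltW y0)// ler_piMl// ltW.
Qed.

(** The monotonicity of [sinh x / x], cross-multiplied so as to include 0. *)
Lemma sinh_ratio x y : 0 <= x -> x <= y -> y * sinh x <= x * sinh y.
Proof.
move=> x0 xy; have [y0|y0] := eqVneq y 0.
  have -> : x = 0 by lra.
  by rewrite y0.
have yp : 0 < y by rewrite lt_neqAle eq_sym y0 (le_trans x0).
have := @sinh_scale (x / y) y; rewrite divfK// ?gt_eqF// => H.
rewrite mulrC -ler_pdivlMr// mulrAC; apply: H; last exact: ltW.
by rewrite divr_ge0 ?(ltW yp)//= ler_pdivrMr// mul1r.
Qed.

Lemma sinh_ratio_sqr p q x : `|q| <= p ->
  p ^+ 2 * sinh (q * x) ^+ 2 <= q ^+ 2 * sinh (p * x) ^+ 2.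
Proof.
move=> qp; have p0 : 0 <= p by apply: le_trans qp.
wlog q0 : q qp / 0 <= q => [H|].
  have [q0|/ltW q0] := leP 0 q; first exact: (H q).
  have := H (- q); rewrite normrN mulNr sinhN !sqrrN; apply => //.
  by rewrite oppr_ge0.
wlog x0 : x / 0 <= x => [H|].
  have [x0|/ltW x0] := leP 0 x; first exact: (H x).
  have := H (- x); rewrite !mulrN !sinhN !sqrrN; apply => //.
  by rewrite oppr_ge0.
have [->|xn0] := eqVneq x 0; first by rewrite !mulr0 sinh0 expr0n !mulr0.
have xp : 0 < x by rewrite lt_neqAle eq_sym xn0.
rewrite ger0_norm// in qp.
have h : p * sinh (q * x) <= q * sinh (p * x).
  rewrite -(ler_pM2r xp) mulrAC [leRHS]mulrAC.
  by rewrite sinh_ratio ?mulr_ge0// ler_wpM2r.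
have sq := @sinh_ge0 (q * x) (mulr_ge0 q0 x0).
have sp := @sinh_ge0 (p * x) (mulr_ge0 p0 x0).
by rewrite -!exprMn; apply: lerXn2r => //; rewrite nnegrE mulr_ge0.
Qed.

(** Writing both sides through half-angles, the difference of the two sides is
    a positive multiple of
    [(p - 2)^2 sinh^2 (p d) - p^2 sinh^2 ((p - 2) d)], where
    [d = (x - y) / 4]. *)
Lemma stroock_varopoulos p x y : 1 <= p ->
  4 * (p - 1) * (expR (p * x / 2) - expR (p * y / 2)) ^+ 2 <=
  p ^+ 2 * ((expR x - expR y) * (expR ((p - 1) * x) - expR ((p - 1) * y))).
Proof.
move=> p1; pose d := (x - y) / 4; pose M := expR (p * (x + y) / 4).
pose a := expR (p * d); pose b := expR ((p - 2) * d).
have a0 : a != 0 by rewrite gt_eqF// expR_gt0.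
have b0 : b != 0 by rewrite gt_eqF// expR_gt0.
have aV : expR (- (p * d)) = a^-1 by rewrite expRN.
have bV : expR (- ((p - 2) * d)) = b^-1 by rewrite expRN.
have -> : expR (p * x / 2) = M * a.
  by rewrite -expRD; congr expR; rewrite /d; field.
have -> : expR (p * y / 2) = M * a^-1.
  by rewrite -aV -expRD; congr expR; rewrite /d; field.
have -> : (expR x - expR y) * (expR ((p - 1) * x) - expR ((p - 1) * y)) =
    M ^+ 2 * (a ^+ 2 + a^-1 ^+ 2 - b ^+ 2 - b^-1 ^+ 2).
  rewrite mulrBl !mulrBr mulrDr -aV -bV /M /a /b -!expRM_natl -!expRD.
  have -> : x + (p - 1) * x = 2 * (p * (x + y) / 4) + 2 * (p * d).
    by rewrite /d; field.
  have -> : y + (p - 1) * y = 2 * (p * (x + y) / 4) + 2 * (- (p * d)).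
    by rewrite /d; field.
  have -> : x + (p - 1) * y = 2 * (p * (x + y) / 4) + 2 * (- ((p - 2) * d)).
    by rewrite /d; field.
  have -> : y + (p - 1) * x = 2 * (p * (x + y) / 4) + 2 * ((p - 2) * d).
    by rewrite /d; field.
  by ring.
have := @sinh_ratio_sqr p (p - 2) d.
have -> : `|p - 2| <= p by rewrite ler_norml; lra.
move=> /(_ isT); rewrite /sinh aV bV -/a -/b => h.
have M0 : 0 <= M ^+ 2 by rewrite sqr_ge0.
rewrite -subr_ge0.
set u := (a - a^-1) / 2 in h; set v := (b - b^-1) / 2 in h.
have -> : a ^+ 2 + a^-1 ^+ 2 - b ^+ 2 - b^-1 ^+ 2 = 4 * u ^+ 2 - 4 * v ^+ 2.
  by rewrite /u /v; field; rewrite a0 b0.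
have -> : M * a - M * a^-1 = M * (2 * u) by rewrite /u; field.
have -> : p ^+ 2 * (M ^+ 2 * (4 * u ^+ 2 - 4 * v ^+ 2))
  - 4 * (p - 1) * (M * (2 * u)) ^+ 2 =
  4 * M ^+ 2 * ((p - 2) ^+ 2 * u ^+ 2 - p ^+ 2 * v ^+ 2) by ring.
by rewrite mulr_ge0 ?subr_ge0// mulr_ge0.
Qed.

End HyperbolicSine.

(** * The two-point inequality and the convexity of the profile *)

Section TwoPoint.
Variable R : realType.
Implicit Types x y : R.

(** The entropy of the density [(2 y, 2 (1 - y))] on two points with the uniform
    probability. *)
Definition deficit y : R := ln 2 - binent y.

(** Four times the Dirichlet form of the square root of the same density. *)
Definition bit_energy y : R := 2 - 4 * Num.sqrt (y * (1 - y)).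

(** The entropy has derivative [- logit y]; with [L = logit y], the quantities
    [cosh (L / 2)] and [sinh (L / 2)] are algebraic in [y] and [sqrt (y (1 - y))],
    which turns the shape of the curve into a property of [sinh]. *)
Definition logit y : R := ln (1 - y) - ln y.

Lemma sinh_ge x : 0 <= x -> x <= sinh x.
Proof.
move=> x0; rewrite -subr_ge0.
have df y : is_derive y 1 (fun z : R => sinh z - z) (cosh y - 1).
  exact: is_deriveB1 (is_derive_sinh y) (is_derive_id _ _).
have {1}<- : sinh 0 - 0 = 0 :> R by rewrite sinh0 subr0.
apply: (is_derive_ge0_le x0 (is_derive_within (fun y _ => df y)) (fun y _ => df y)).
move=> y /andP[y0 _]; rewrite subr_ge0.
have {1}<- : cosh 0 = 1 :> R by rewrite /cosh oppr0 expR0; field.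
exact/cosh_le/ltW.
Qed.

Lemma sinh_le_cosh x : 0 <= x -> sinh x <= x * cosh x.
Proof.
move=> x0; rewrite -subr_ge0.
have df y : is_derive y 1 (fun z : R => z * cosh x - sinh z) (1 * cosh x - cosh y).
  apply: is_deriveB1 (is_derive_sinh y).
  exact: is_deriveMr1 (is_derive_id _ _).
have {1}<- : 0 * cosh x - sinh 0 = 0 :> R by rewrite sinh0 subr0 mul0r.
apply: (is_derive_ge0_le x0 (is_derive_within (fun y _ => df y)) (fun y _ => df y)).
by move=> y /andP[y0 yx]; rewrite mul1r subr_ge0 cosh_le ?ltW.
Qed.

Lemma sqrt_expR x : Num.sqrt (expR x) = expR (x / 2).
Proof.
have -> : expR x = expR (x / 2) ^+ 2 by rewrite -expRM_natl; congr expR; field.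
by rewrite sqrtr_sqr ger0_norm// expR_ge0.
Qed.

Lemma sqr_expR_half_ln x : 0 < x -> expR (ln x / 2) ^+ 2 = x.
Proof. by move=> x0; rewrite -expRM_natl mulrC divfK// lnK. Qed.

Lemma sqrt_bit y : 0 < y < 1 ->
  Num.sqrt (y * (1 - y)) = expR (ln y / 2) * expR (ln (1 - y) / 2).
Proof.
move=> /andP[y0 y1]; rewrite -expRD -mulrDl -sqrt_expR expRD !lnK// posrE.
by rewrite subr_gt0.
Qed.

Lemma cosh_logit y : 0 < y < 1 ->
  2 * cosh (logit y / 2) = (Num.sqrt (y * (1 - y)))^-1.
Proof.
move=> y01; have /andP[y0 y1] := y01; rewrite sqrt_bit// /cosh /logit expRN.
rewrite [(ln (1 - y) - ln y) / 2]mulrBl expRB.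
set a := expR (ln (1 - y) / 2); set b := expR (ln y / 2).
have a0 : a != 0 by rewrite gt_eqF// expR_gt0.
have b0 : b != 0 by rewrite gt_eqF// expR_gt0.
have a2 : a ^+ 2 = 1 - y by apply: sqr_expR_half_ln; rewrite subr_gt0.
have b2 : b ^+ 2 = y by exact: sqr_expR_half_ln.
transitivity ((a ^+ 2 + b ^+ 2) / (a * b)); first by field; rewrite a0 b0.
by rewrite a2 b2 subrK div1r mulrC.
Qed.

Lemma sinh_logit y : 0 < y < 1 ->
  2 * sinh (logit y / 2) = (1 - 2 * y) / Num.sqrt (y * (1 - y)).
Proof.
move=> y01; have /andP[y0 y1] := y01; rewrite sqrt_bit// /sinh /logit expRN.
rewrite [(ln (1 - y) - ln y) / 2]mulrBl expRB.
set a := expR (ln (1 - y) / 2); set b := expR (ln y / 2).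
have a0 : a != 0 by rewrite gt_eqF// expR_gt0.
have b0 : b != 0 by rewrite gt_eqF// expR_gt0.
have a2 : a ^+ 2 = 1 - y by apply: sqr_expR_half_ln; rewrite subr_gt0.
have b2 : b ^+ 2 = y by exact: sqr_expR_half_ln.
transitivity ((a ^+ 2 - b ^+ 2) / (a * b)); first by field; rewrite a0 b0.
by rewrite a2 b2 [b * a]mulrC; congr (_ / _); ring.
Qed.

Lemma logit_ge0 y : 0 < y <= 2^-1 -> 0 <= logit y.
Proof. by move=> ?; rewrite subr_ge0 ler_ln ?posrE; lra. Qed.

Lemma logit_le y y' : 0 < y -> y <= y' -> y' < 1 -> logit y' <= logit y.
Proof. by move=> ? ? ?; rewrite lerB// ler_ln ?posrE; lra. Qed.

Lemma is_derive_onem x : is_derive x 1 (fun z : R => 1 - z) (- 1).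
Proof.
apply: (is_derive_eq (is_deriveB1 (is_derive_cst (1 : R) x 1) (is_derive_id x (1 : R)))).
by rewrite sub0r.
Qed.

Lemma is_derive_deficit y : 0 < y < 1 -> is_derive y 1 deficit (- logit y).
Proof.
move=> /andP[y0 y1]; have z0 : 0 < 1 - y by rewrite subr_gt0.
have d0 := is_derive_onem y.
have d1 := is_deriveM1 (is_derive_id y (1 : R)) (is_derive_ln1 y0 (is_derive_id y (1 : R))).
have d2 := is_deriveM1 d0 (@is_derive_ln1 _ (fun z => 1 - z) _ _ z0 d0).
apply: (is_derive_eq (is_deriveB1 (is_derive_cst (ln 2 : R) y 1)
  (is_deriveB1 (is_deriveN1 d1) d2))).
by rewrite /logit; field; rewrite !gt_eqF.
Qed.

Lemma is_derive_bit_energy y : 0 < y < 1 ->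
  is_derive y 1 bit_energy (- (4 * sinh (logit y / 2))).
Proof.
move=> y01; have /andP[y0 y1] := y01.
have z0 : 0 < 1 - y by rewrite subr_gt0.
have r0 : 0 < y * (1 - y) by rewrite mulr_gt0.
have d1 := is_deriveM1 (is_derive_id y (1 : R)) (is_derive_onem y).
have d2 := @is_derive_sqrt1 _ (fun z => z * (1 - z)) _ _ r0 d1.
apply: (is_derive_eq (is_deriveB1 (is_derive_cst (2 : R) y 1) (is_deriveMl1 4 d2))).
have -> : 4 * sinh (logit y / 2) = 2 * (2 * sinh (logit y / 2)) by ring.
by rewrite sinh_logit//; field; rewrite gt_eqF// sqrtr_gt0.
Qed.

Lemma half_onem : 1 - 2^-1 = 2^-1 :> R.
Proof. by field. Qed.

Lemma binent_half : binent (2^-1 : R) = ln 2.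
Proof. by rewrite /binent half_onem lnV ?posrE//; field. Qed.

Lemma sqrt_quarter : Num.sqrt (2^-1 * (1 - 2^-1)) = 2^-1 :> R.
Proof. by rewrite half_onem -expr2 sqrtr_sqr ger0_norm. Qed.

Lemma deficit_half : deficit 2^-1 = 0.
Proof. by rewrite /deficit binent_half subrr. Qed.

Lemma bit_energy_half : bit_energy 2^-1 = 0.
Proof. by rewrite /bit_energy sqrt_quarter; field. Qed.

Lemma deficitC y : deficit (1 - y) = deficit y.
Proof. by rewrite /deficit /binent !subKr; ring. Qed.

Lemma bit_energyC y : bit_energy (1 - y) = bit_energy y.
Proof. by rewrite /bit_energy subKr [(1 - y) * y]mulrC. Qed.

(** As [y] runs from 1/2 to 0, the curve [(deficit y, bit_energy y)] has slope
    [4 sinh (L / 2) / L] with [L = logit y], which increases because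
    [sinh x / x] does. Thus the curve is convex and lies above its tangent
    [x |-> a x - b]; at [y0 = 1/2] the slope is the limit 2. *)
Lemma bit_energy_tangent y0 : 0 < y0 <= 2^-1 -> exists a b : R,
  [/\ 2 <= a <= (Num.sqrt (y0 * (1 - y0)))^-1, 0 <= b,
      a * deficit y0 - b = bit_energy y0
    & forall y, 0 < y < 1 -> a * deficit y - b <= bit_energy y].
Proof.
move=> /andP[y00 y02].
have y01 : 0 < y0 < 1 by lra.
have L0 : 0 <= logit y0 by apply: logit_ge0; rewrite y00.
have [a [a2 aS age ale]] : exists a : R, [/\ 2 <= a,
    a <= 2 * cosh (logit y0 / 2),
    forall L, 0 <= L -> L <= logit y0 -> 4 * sinh (L / 2) <= a * L
  & forall L, logit y0 <= L -> a * L <= 4 * sinh (L / 2)].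
  have [L00|L0n] := eqVneq (logit y0) 0.
    exists 2; split=> //.
    - by rewrite L00 mul0r /cosh oppr0 expR0; lra.
    - move=> L l0; rewrite L00 => l1; have -> : L = 0 by lra.
      by rewrite mul0r sinh0 !mulr0.
    - move=> L; rewrite L00 => l0; have := @sinh_ge (L / 2).
      by rewrite divr_ge0// => /(_ isT); lra.
  have L0p : 0 < logit y0 by rewrite lt_neqAle eq_sym L0n.
  exists (4 * sinh (logit y0 / 2) / logit y0); split.
  - rewrite ler_pdivlMr//; have := @sinh_ge (logit y0 / 2).
    by rewrite divr_ge0// => /(_ isT); lra.
  - rewrite ler_pdivrMr//; have := @sinh_le_cosh (logit y0 / 2).
    by rewrite divr_ge0// => /(_ isT); lra.
  - move=> L l0 l1; rewrite mulrAC ler_pdivlMr//.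
    have := @sinh_ratio _ (L / 2) (logit y0 / 2).
    by rewrite divr_ge0// ler_pM2r// => /(_ isT l1); lra.
  - move=> L l1; rewrite mulrAC ler_pdivrMr//.
    have := @sinh_ratio _ (logit y0 / 2) (L / 2).
    by rewrite divr_ge0// ler_pM2r// => /(_ isT l1); lra.
pose g y := bit_energy y - a * deficit y.
pose g' y := - (4 * sinh (logit y / 2)) - a * - logit y.
have dg y : 0 < y < 1 -> is_derive y 1 g (g' y).
  move=> y1; apply: is_deriveB1; first exact: is_derive_bit_energy.
  by apply: is_deriveMl1; exact: is_derive_deficit.
have gmin' y : 0 < y <= 2^-1 -> g y0 <= g y.
  move=> /andP[yp y2]; have [yy0|/ltW y0y] := leP y y0.
    apply: (@is_derive_le0_ge _ g g' _ _ yy0).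
    + by apply: (@is_derive_within _ g g') => z zi; apply: dg; lra.
    + by move=> z zi; apply: dg; lra.
    move=> z zi; rewrite /g'; have := ale (logit z); rewrite logit_le; [|lra..].
    by move=> /(_ isT); lra.
  apply: (@is_derive_ge0_le _ g g' _ _ y0y).
  - by apply: (@is_derive_within _ g g') => z zi; apply: dg; lra.
  - by move=> z zi; apply: dg; lra.
  move=> z zi; rewrite /g'; have := age (logit z); rewrite logit_le; [|lra..].
  rewrite logit_ge0; last lra.
  by move=> /(_ isT isT); lra.
have gmin y : 0 < y < 1 -> g y0 <= g y.
  move=> y1; have [y2|y2] := leP y 2^-1; first by apply: gmin'; lra.
  have <- : g (1 - y) = g y by rewrite /g bit_energyC deficitC.
  by apply: gmin'; lra.
exists a, (a * deficit y0 - bit_energy y0); split.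
- by rewrite a2 -cosh_logit.
- have := gmin 2^-1; rewrite /g deficit_half bit_energy_half => H.
  have : bit_energy y0 - a * deficit y0 <= 0 - a * 0 by apply: H; lra.
  by lra.
- by ring.
- by move=> y y1; have := gmin y y1; rewrite /g; lra.
Qed.

End TwoPoint.

(** * The coefficient [C_LSI] *)

Section Clamp.
Context {R : realType}.
Local Open Scope classical_set_scope.
Local Open Scope ring_scope.
Implicit Types a b x : R.

Definition clamp a b x : R := Num.min b (Num.max a x).

Lemma clamp_itv a b x : a <= b -> a <= clamp a b x <= b.
Proof.
by move=> ab; rewrite /clamp le_min ab le_max lexx/= ge_min lexx.
Qed.

Lemma clamp_id a b x : a <= x <= b -> clamp a b x = x.
Proof. by move=> /andP[ax xb]; rewrite /clamp max_r// min_r. Qed.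

Lemma continuous_clamp a b : continuous (clamp a b).
Proof.
move=> x; apply: (@continuous_min _ _ (cst b) (fun y => Num.max a y)).
  exact: cst_continuous.
by apply: (@continuous_max _ _ (cst a) id); [exact: cst_continuous|exact: cvg_id].
Qed.

Lemma continuous_within_clamp a b (f : R -> R) : a <= b ->
  {within `[a, b], continuous f} -> continuous (fun x => f (clamp a b x)).
Proof.
move=> ab /subspace_continuousP cf x.
have cab : `[a, b]%classic (clamp a b x) by rewrite /= in_itv/= clamp_itv.
have cc : clamp a b z @[z --> x] --> within `[a, b]%classic (nbhs (clamp a b x)).
  move=> A H; have := @continuous_clamp a b x _ H.
  apply: (@filterS _ (nbhs x)) => y; apply.
  by rewrite /= in_itv/= clamp_itv.
exact: (cvg_comp _ _ cc (cf _ cab)).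
Qed.

End Clamp.

Section Coefficient.
Variable R : realType.
Local Open Scope classical_set_scope.
Local Open Scope ring_scope.
Implicit Types x y : R.

Lemma ln2_gt0 : 0 < ln 2 :> R.
Proof. by apply: ln_gt0; rewrite ltr1n. Qed.

Lemma ln2_le1 : ln 2 <= 1 :> R.
Proof. by have := @le_ln1Dx R 1; rewrite -[1 + 1]/(2 : R); apply; lra. Qed.

Lemma xlnx_bound y : `|y| <= 1 -> `|y * ln y| <= 2 * Num.sqrt `|y|.
Proof.
have [y0 _|y0] := leP y 0.
  by rewrite ln0// mulr0 normr0 mulr_ge0// sqrtr_ge0.
rewrite gtr0_norm// => y1; set s := Num.sqrt y.
have s0 : 0 < s by rewrite sqrtr_gt0.
have ys : y = s ^+ 2 by rewrite sqr_sqrtr// ltW.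
have lny : - ln y = 2 * ln s^-1.
  by rewrite ys lnXn// lnV ?posrE// mulrN mulr_natl.
have l1 : ln s^-1 < s^-1 by apply: ln_sublinear; rewrite invr_gt0.
have l0 : ln y <= 0 by rewrite ln_le0.
rewrite normrM gtr0_norm// ler0_norm// lny ys.
have -> : 2 * s = s ^+ 2 * (2 * s^-1) by field; rewrite gt_eqF.
by rewrite ler_wpM2l ?sqr_ge0// ler_wpM2l// ltW.
Qed.

Lemma continuous_xlnx0 : {for 0, continuous (fun y : R => y * ln y)}.
Proof.
have cs : 2 * Num.sqrt `|y| @[y --> (0 : R)] --> (0 : R).
  rewrite -[X in _ --> X](mulr0 2) -[X in _ * X]sqrtr0 -[X in Num.sqrt X](normr0 R).
  apply: cvgMr; apply: continuous_comp; first exact: norm_continuous.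
  exact: sqrt_continuous.
rewrite /prop_for /continuous_at mul0r; apply: norm_cvg0.
apply: (squeeze_cvgr _ (cvg_cst 0) cs).
have : \forall y \near (0 : R), `|y| < 1 by apply: nbhs0_lt; exact: ltr01.
by apply: filterS => y y1; rewrite normr_ge0 xlnx_bound// ltW.
Qed.

Lemma continuous_deficit y : 0 <= y < 1 -> {for y, continuous (@deficit R)}.
Proof.
move=> /andP[]; rewrite le_eqVlt => /predU1P[<- _|y0 y1]; last first.
  by apply: (@is_derive_continuous _ _ _ (- logit y)); apply: is_derive_deficit; rewrite y0.
have d0 := is_derive_onem (0 : R).
have z0 : 0 < 1 - 0 :> R by rewrite subr0.
have d2 := is_deriveM1 d0 (@is_derive_ln1 _ (fun z => 1 - z) _ _ z0 d0).
apply: cvgB; first exact: cvg_cst.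
apply: cvgB; last exact: (is_derive_continuous d2).
exact: cvgN continuous_xlnx0.
Qed.

Lemma within_deficit : {within `[0, 2^-1], continuous (@deficit R)}.
Proof.
apply: continuous_in_subspaceT => y; rewrite inE/= in_itv/= => y2.
by apply: continuous_deficit; lra.
Qed.

Lemma deficit0 : deficit 0 = ln 2 :> R.
Proof. by rewrite /deficit /binent mul0r subr0 ln1 mulr0 subr0 oppr0 subr0. Qed.

Lemma deficit_lt y y' : 0 <= y -> y < y' -> y' <= 2^-1 -> deficit y' < deficit y.
Proof. by move=> y0 yy y2; rewrite ltrD2l ltrN2 binent_lt. Qed.

Lemma deficit_itv y : 0 <= y <= 2^-1 -> 0 <= deficit y <= ln 2.
Proof.
move=> /andP[y0 yh]; apply/andP; split.
  rewrite -deficit_half; move: yh; rewrite le_eqVlt => /predU1P[->//|yh].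
  exact/ltW/deficit_lt.
rewrite -deficit0; move: y0; rewrite le_eqVlt => /predU1P[->//|y0].
exact/ltW/deficit_lt.
Qed.

Lemma deficit_surj x : 0 <= x <= ln 2 -> exists2 y, 0 <= y <= 2^-1 & deficit y = x.
Proof.
move=> x2; have h2 : 0 <= 2^-1 :> R by rewrite invr_ge0.
have := @IVT _ _ _ _ x h2 within_deficit.
have l2 := ltW ln2_gt0.
rewrite deficit0 deficit_half min_r ?max_l// => /(_ x2)[y].
by rewrite in_itv/= => ? ?; exists y.
Qed.

Lemma binent_paramP x : 0 <= x <= ln 2 ->
  0 <= binent_param x <= 2^-1 /\ deficit (binent_param x) = x.
Proof.
move=> /deficit_surj[y y2 yx].
by apply: (@xgetPex _ 0 [set y : R | 0 <= y <= 2^-1 /\ ln 2 - binent y = x]); exists y.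
Qed.

Lemma binent_param_deficit y : 0 <= y <= 2^-1 -> binent_param (deficit y) = y.
Proof.
move=> y2.
have [p2 pE] := binent_paramP (deficit_itv y2).
have [py|yp|//] := ltgtP (binent_param (deficit y)) y.
  by have := deficit_lt (andP p2).1 py (andP y2).2; rewrite pE ltxx.
by have := deficit_lt (andP y2).1 yp (andP p2).2; rewrite pE ltxx.
Qed.

Lemma binent_param_mono :
  {in `[0, ln 2] &, {mono @binent_param R : x y /~ x <= y}}.
Proof.
apply: le_nmono_in => x y; rewrite !in_itv/= => x2 y2 xy.
have [px Ex] := binent_paramP x2; have [py Ey] := binent_paramP y2.
rewrite ltNge; apply/negP; rewrite le_eqVlt => /predU1P[E|lt].
  by move: xy; rewrite -Ex -Ey E ltxx.
have := deficit_lt (andP py).1 lt (andP px).2; rewrite Ex Ey.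
by rewrite ltNge (ltW xy).
Qed.

(** Monotone and onto, hence continuous. *)
Lemma within_binent_param : {within `[0, ln 2], continuous (@binent_param R)}.
Proof.
apply: segment_dec_surj_continuous; first exact: binent_param_mono.
move=> y /=; rewrite !in_itv/= -deficit0 -[X in _ <= _ <= binent_param X]deficit_half.
rewrite !binent_param_deficit => [y2||]; [|lra..].
exists (deficit y); last exact: binent_param_deficit y2.
by rewrite /= in_itv/= deficit0 deficit_itv.
Qed.

Lemma C_LSI0 : C_LSI 0 = 2 :> R.
Proof. by rewrite /C_LSI eqxx. Qed.

Lemma C_LSI_neq0 x : 0 < x <= ln 2 -> C_LSI x = bit_energy (binent_param x) / x.
Proof.
move=> /andP[x0 x2]; rewrite /C_LSI gt_eqF//.
have [_ E] : 0 <= binent_param x <= 2^-1 /\ deficit (binent_param x) = x.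
  by apply: binent_paramP; rewrite ltW.
by rewrite -[ln 2 - _]/(deficit _) E.
Qed.

(** The tangent to the profile at the point of abscissa [x]. The profile
    vanishes at 0 and is convex, so its slope [a] there is at least the slope
    [C_LSI x] of the chord from the origin. *)
Lemma C_LSI_tangent x : 0 <= x < ln 2 -> exists a b : R,
  [/\ a * x - b = C_LSI x * x, C_LSI x <= a <=
      (Num.sqrt (binent_param x * (1 - binent_param x)))^-1
    & forall y, 0 < y < 1 -> a * deficit y - b <= bit_energy y].
Proof.
move=> /andP[x0 x2].
have [yh yE] : 0 <= binent_param x <= 2^-1 /\ deficit (binent_param x) = x.
  by apply: binent_paramP; rewrite x0 ltW.
set y := binent_param x in yh yE *.
have y0 : 0 < y.
  rewrite lt_neqAle eq_sym (andP yh).1 andbT; apply/eqP => E.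
  by move: x2; rewrite -yE E deficit0 ltxx.
have [a [b [/andP[a2 aS] b0 ab tan]]] : exists a b : R,
  [/\ 2 <= a <= (Num.sqrt (y * (1 - y)))^-1, 0 <= b,
      a * deficit y - b = bit_energy y
    & forall y, 0 < y < 1 -> a * deficit y - b <= bit_energy y].
  by apply: bit_energy_tangent; rewrite y0 (andP yh).2.
have CE : C_LSI x * x = bit_energy y.
  have [x00|xn0] := eqVneq x 0.
    rewrite x00 mulr0; have -> : y = 2^-1; last by rewrite bit_energy_half.
    by rewrite -(@binent_param_deficit 2^-1) ?deficit_half -?x00//; lra.
  by rewrite C_LSI_neq0 ?divfK// (ltW x2) andbT lt_neqAle eq_sym xn0.
exists a, b; split => //; first by rewrite -yE ab yE.
rewrite aS andbT.
have [x00|xn0] := eqVneq x 0; first by rewrite x00 C_LSI0.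
have xp : 0 < x by rewrite lt_neqAle eq_sym xn0.
by rewrite -(ler_pM2r xp) CE -ab yE; lra.
Qed.

Lemma C_LSI_ge2 x : 0 <= x <= ln 2 -> 2 <= C_LSI x.
Proof.
move=> /andP[x0 x2].
have [x00|xn0] := eqVneq x 0; first by rewrite x00 C_LSI0.
have xp : 0 < x by rewrite lt_neqAle eq_sym xn0.
rewrite C_LSI_neq0 ?xp// ler_pdivlMr//.
have [yh yE] : 0 <= binent_param x <= 2^-1 /\ deficit (binent_param x) = x.
  by apply: binent_paramP; rewrite x0.
set y := binent_param x in yh yE *.
have [y0|y0] := eqVneq y 0.
  rewrite y0 /bit_energy mul0r sqrtr0 mulr0 subr0.
  by have := ln2_le1; lra.
have yp : 0 < y by rewrite lt_neqAle eq_sym y0 (andP yh).1.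
have [a [b [/andP[a2 _] _]]] : exists a b : R,
  [/\ 2 <= a <= (Num.sqrt (2^-1 * (1 - 2^-1)))^-1, 0 <= b,
      a * deficit 2^-1 - b = bit_energy 2^-1
    & forall y, 0 < y < 1 -> a * deficit y - b <= bit_energy y].
  by apply: bit_energy_tangent; rewrite invr_gt0 ltr0n lexx.
rewrite deficit_half bit_energy_half mulr0 => bE tan.
have : a * deficit y - b <= bit_energy y by apply: tan; lra.
have : 2 * x <= a * x by rewrite ler_pM2r.
by rewrite yE; lra.
Qed.

(** At 0 the quotient is 0 / 0, and continuity there comes from squeezing
    [C_LSI x] between 2 and [1 / sqrt (y (1 - y))], where [y] tends to 1/2. *)
Lemma continuous_C_LSI : continuous (fun x : R => C_LSI (clamp 0 (ln 2) x)).
Proof.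
move=> x; rewrite /continuous_at; set c := clamp 0 (ln 2).
have l0 : 0 <= ln 2 :> R by rewrite ltW// ln2_gt0.
have cI z : 0 <= c z <= ln 2 by apply: clamp_itv.
have cc : c @ x --> c x by exact: continuous_clamp.
have cy : binent_param (c z) @[z --> x] --> binent_param (c x).
  exact: (continuous_within_clamp l0 within_binent_param).
have cr : Num.sqrt (binent_param (c z) * (1 - binent_param (c z))) @[z --> x] -->
    Num.sqrt (binent_param (c x) * (1 - binent_param (c x))).
  have cm : binent_param (c z) * (1 - binent_param (c z)) @[z --> x] -->
      binent_param (c x) * (1 - binent_param (c x)).
    exact: (cvgM cy (cvgB (cvg_cst (1 : R)) cy)).
  exact: (cvg_comp _ _ cm (@sqrt_continuous R _)).
have [cx0|cxn0] := eqVneq (c x) 0; last first.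
  have cxp : 0 < c x by rewrite lt_neqAle eq_sym cxn0; case/andP: (cI x).
  rewrite C_LSI_neq0 ?cxp ?(andP (cI x)).2//.
  have : bit_energy (binent_param (c z)) / c z @[z --> x] -->
      bit_energy (binent_param (c x)) / c x.
    exact: (cvgM (cvgB (cvg_cst (2 : R)) (cvgM (cvg_cst (4 : R)) cr)) (cvgV cxn0 cc)).
  apply: cvg_trans; apply: near_eq_cvg.
  have : \forall z \near x, 0 < c z by exact: (cvgr_gt _ cc).
  by apply: filterS => z cz; rewrite C_LSI_neq0// cz (andP (cI z)).2.
have y2 : binent_param (c x) = 2^-1.
  by rewrite cx0 -deficit_half binent_param_deficit//; lra.
rewrite cx0 C_LSI0.
rewrite y2 sqrt_quarter in cr.
have cr' : (Num.sqrt (binent_param (c z) * (1 - binent_param (c z))))^-1 @[z --> x] --> (2 : R).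
  by rewrite -[X in _ --> X]invrK; apply: cvgV => //; rewrite invr_neq0.
apply: (squeeze_cvgr _ (cvg_cst (2 : R)) cr').
have : \forall z \near x, c z < ln 2.
  by apply: (cvgr_lt _ cc); rewrite cx0 ln2_gt0.
apply: filterS => z cz; rewrite C_LSI_ge2//=.
have [|a [b [_ /andP[Ca aS] _]]] := @C_LSI_tangent (c z).
  by rewrite (andP (cI z)).1.
exact: le_trans Ca aS.
Qed.

End Coefficient.

(** * Separable differential equations *)

Section SeparableODE.
Variable R : realType.
Local Open Scope classical_set_scope.
Local Open Scope ring_scope.

Lemma continuous_primitive (k : R -> R) (a : R) : continuous k ->
  exists F : R -> R, forall x, a < x -> is_derive x 1 F (k x).
Proof.
move=> ck; exists (fun x => \int[lebesgue_measure]_(t in `[a, x]) k t)%R => x ax.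
have x1 : x < x + 1 by rewrite ltrDl.
have ik : lebesgue_measure.-integrable `[a, x + 1] (EFin \o k).
  apply: continuous_compact_integrable; first exact: segment_compact.
  exact: continuous_subspaceT.
have [dF F'] := continuous_FTC1_closed x1 ik ax (ck x).
by rewrite -F' derive1E; exact: derivableP.
Qed.

Lemma is_derive0_eq (f : R -> R) (a b : R) : a <= b ->
  {within `[a, b], continuous f} ->
  (forall x, a < x < b -> is_derive x 1 f 0) -> f a = f b.
Proof.
move=> ab cf df; apply/eqP; rewrite eq_le; apply/andP; split.
  exact: (@is_derive_ge0_le _ f (fun=> 0) _ _ ab cf df).
exact: (@is_derive_le0_ge _ f (fun=> 0) _ _ ab cf df).
Qed.

Lemma within_right_continuous (f : R -> R) (a b : R) :
  f x @[x --> a^'+] --> f a -> (forall x, a < x <= b -> {for x, continuous f}) ->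
  {within `[a, b], continuous f}.
Proof.
move=> fa fc; apply/subspace_continuousP => x; rewrite /= in_itv/= => /andP[].
rewrite le_eqVlt => /predU1P[<- ab|ax xb]; last first.
  have cfx : f @ x --> f x by have := fc x; rewrite ax xb => /(_ isT).
  exact: cvg_within_filter cfx.
move=> A fA; have := fa _ fA; have := nbhs_singleton fA => Aa.
rewrite /fmap/= /at_right /within/=; apply: (@filterS _ (nbhs a)) => y H.
rewrite in_itv/= => /andP[]; rewrite le_eqVlt => /predU1P[<-//|ay _].
exact: H.
Qed.

(** The equation [u' = g u] separates: with [F' = 1 / g], every solution
    satisfies [F (u t) = F (u 0) + t]. The bounds on [g] make [F] a bijection
    onto a half-line, so no Lipschitz condition is needed. *)
Lemma separable_ode (g : R -> R) (m M u0 : R) :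
  continuous g -> 0 < m -> (forall x, m <= g x <= M) ->
  exists u : R -> R,
    [/\ u 0 = u0, forall t : R, 0 <= t -> is_derive t 1 u (g (u t)) &
      forall v : R -> R, v 0 = u0 -> v t @[t --> 0^'+] --> v 0 ->
        (forall t : R, 0 < t -> is_derive t 1 v (g (v t))) ->
        (forall t : R, 0 <= t -> u0 <= v t) ->
        forall t : R, 0 <= t -> v t = u t].
Proof.
move=> cg m0 gmM.
have g0 x : 0 < g x by apply: lt_le_trans (andP (gmM x)).1.
have M0 : 0 < M by have /andP[_] := gmM 0; exact: lt_le_trans.
have ck : continuous (fun x => (g x)^-1).
  by move=> x; apply: cvgV; [rewrite gt_eqF|exact: cg].
have [G dG] := @continuous_primitive _ (u0 - 1) ck.
pose F x := G x - G u0.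
have au : u0 - 1 < u0 by rewrite gtrBl.
have dF (x : R) : u0 - 1 < x -> is_derive x 1 F (g x)^-1.
  move=> ax; have dc := is_derive_cst (G u0) x (1 : R).
  by apply: (is_derive_eq (is_deriveB1 (dG _ ax) dc)); rewrite subr0.
have cF (x y : R) : u0 - 1 < x -> {within `[x, y], continuous F}.
  move=> ax; apply: (@is_derive_within _ F (fun z => (g z)^-1)) => z /andP[xz _].
  by apply: dF; exact: lt_le_trans xz.
have Fge x y : u0 - 1 < x -> x <= y -> (y - x) / M <= F y - F x.
  move=> ax xy.
  suff : F x - x / M <= F y - y / M by rewrite mulrBl; lra.
  apply: (@is_derive_ge0_le _ (fun z => F z - z / M) (fun z => (g z)^-1 - 1 / M)) => //.
  - apply: (@is_derive_within _ _ (fun z => (g z)^-1 - 1 / M)) => z /andP[xz _].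
    apply: is_deriveB1; first by apply: dF; exact: lt_le_trans xz.
    exact: is_deriveMr1 (is_derive_id _ _).
  - move=> z /andP[xz _]; apply: is_deriveB1; first by apply: dF; exact: lt_trans xz.
    exact: is_deriveMr1 (is_derive_id _ _).
  - move=> z _; rewrite subr_ge0 div1r lef_pV2 ?posrE//.
    by case/andP: (gmM z).
have Finj x y : u0 - 1 < x -> u0 - 1 < y -> F x = F y -> x = y.
  wlog xy : x y / x <= y => [H ax ay E|].
    by have [xy|/ltW yx] := leP x y; [exact: H|apply/esym/H].
  move=> ax ay E; have := Fge _ _ ax xy; rewrite E subrr pmulr_lle0 ?invr_gt0//.
  by rewrite subr_le0 => yx; apply/eqP; rewrite eq_le xy.
pose u t := xget u0 [set x | u0 - 1 < x /\ F x = t].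
have uF x : u0 - 1 < x -> u (F x) = x.
  by move=> ax; apply: xget_unique => // y [ay] /Finj; exact.
have Fu0 : F u0 = 0 by rewrite /F subrr.
have Fsurj t : 0 <= t -> exists2 x, u0 <= x & F x = t.
  move=> t0; have tM : u0 <= u0 + t * M by rewrite lerDl mulr_ge0// ltW.
  have := Fge _ _ au tM; rewrite addrAC subrr add0r mulfK ?gt_eqF// Fu0 subr0 => tF.
  have := @IVT _ F _ _ t tM (cF _ _ au).
  rewrite Fu0 min_l ?max_r ?(le_trans t0)// => H.
  have [|x] := H; first by rewrite tF ?t0.
  by rewrite in_itv/= => /andP[ux _] Fx; exists x.
exists u; split.
- by rewrite -Fu0 uF.
- move=> t /Fsurj[x ux <-]; have ax : u0 - 1 < x by exact: lt_le_trans ux.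
  rewrite uF// -[g x]invrK; apply: is_derive_inverse.
  + near=> y; apply: uF; near: y; exact: lt_nbhsr.
  + near=> y; apply: (@is_derive_continuous _ _ _ (g y)^-1); apply: dF; near: y.
    exact: lt_nbhsr.
  + exact: dF.
  + by rewrite invr_neq0// gt_eqF.
- move=> v v0 cv dv uv t t0.
  have av (s : R) : 0 <= s -> u0 - 1 < v s by move=> /uv; exact: lt_le_trans.
  have dFv (s : R) : 0 < s -> is_derive s 1 (fun s => F (v s) - s) 0.
    move=> s0; have dc := is_derive1_comp (dF _ (av _ (ltW s0))) (dv _ s0).
    apply: (is_derive_eq (is_deriveB1 dc (is_derive_id s (1 : R)))).
    by rewrite mulVf ?subrr// gt_eqF.
  have cFv : {within `[0, t], continuous (fun s => F (v s) - s)}.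
    apply: within_right_continuous => [|s /andP[s0 _]].
      apply: cvgB; last by apply: cvg_at_right_filter; exact: cvg_id.
      apply: continuous_cvg => //.
      exact: (is_derive_continuous (dF _ (av _ (lexx 0)))).
    exact: (is_derive_continuous (dFv _ s0)).
  have := is_derive0_eq t0 cFv.
  rewrite v0 Fu0 subr0 => E.
  have : 0 = F (v t) - t by apply: E => s /andP[s0 _]; exact: dFv.
  by move/esym/eqP; rewrite subr_eq0 => /eqP Fv; rewrite -{2}Fv uF// av.
Unshelve. all: by end_near. Qed.

End SeparableODE.

(** * Tensorization of the log-Sobolev inequality *)

Section CubeRecursion.
Variable n : nat.

Definition flip (i : 'I_n) (x : cube n) : cube n :=
  [ffun j => if j == i then ~~ x j else x j].

Definition cube_cons (b : bool) (x : cube n) : cube n.+1 :=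
  [ffun j => if unlift ord0 j is Some k then x k else b].

Lemma flipK i : involutive (flip i).
Proof. by move=> x; apply/ffunP => j; rewrite !ffunE; case: eqP; rewrite ?negbK. Qed.

Lemma cube_cons0 b x : cube_cons b x ord0 = b.
Proof. by rewrite ffunE unlift_none. Qed.

Lemma cube_consS b x i : cube_cons b x (lift ord0 i) = x i.
Proof. by rewrite ffunE liftK. Qed.

Lemma sum_cubeS (V : nmodType) (F : cube n.+1 -> V) :
  \sum_x F x = \sum_(b : bool) \sum_(x : cube n) F (cube_cons b x).
Proof.
rewrite pair_big/=.
apply: (reindex (fun p : bool * cube n => cube_cons p.1 p.2)).
exists (fun x : cube n.+1 => (x ord0, [ffun i => x (lift ord0 i)] : cube n)) => [[b x] _|x _] /=.
  by rewrite cube_cons0; congr (_, _); apply/ffunP => i; rewrite ffunE cube_consS.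
apply/ffunP => j; have [k ->|->] := unliftP ord0 j.
  by rewrite cube_consS ffunE.
by rewrite cube_cons0.
Qed.

Lemma sum_flip (V : nmodType) i (F : cube n -> V) :
  \sum_x F (flip i x) = \sum_x F x.
Proof. by rewrite [RHS](reindex_inj (inv_inj (flipK i))). Qed.

End CubeRecursion.

Lemma flip_cons0 n b (x : cube n) : flip ord0 (cube_cons b x) = cube_cons (~~ b) x.
Proof.
apply/ffunP => j; rewrite ffunE; have [k ->|->] := unliftP ord0 j.
  by rewrite -[_ == _]/(eq_op _ _) !cube_consS eq_sym (negPf (neq_lift _ _)).
by rewrite eqxx !cube_cons0.
Qed.

Lemma flip_consS n b (x : cube n) i :
  flip (lift ord0 i) (cube_cons b x) = cube_cons b (flip i x).
Proof.
apply/ffunP => j; rewrite ffunE; have [k ->|->] := unliftP ord0 j.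
  by rewrite !cube_consS ffunE (inj_eq lift_inj).
by rewrite (negPf (neq_lift _ _)) !cube_cons0.
Qed.

Section Tensorization.
Variable R : realType.

(** This is [4 * 2 ^+ n] times the Dirichlet form of the square root of [F]. *)
Definition energy n (F : cube n -> R) : R :=
  \sum_x \sum_i (Num.sqrt (F x) - Num.sqrt (F (flip i x))) ^+ 2.

(** This is [2 ^+ n] times the entropy of [F] for the uniform probability. *)
Definition entropy n (F : cube n -> R) : R :=
  \sum_x F x * ln (F x) - (\sum_x F x) * (ln (\sum_x F x) - n%:R * ln 2).

Lemma psum_gt0 (T : finType) (x0 : T) (F : T -> R) :
  (forall x, 0 < F x) -> 0 < \sum_x F x.
Proof.
move=> F0; rewrite (bigD1 x0)//= ltr_pwDl//.
by apply: sumr_ge0 => x _; exact: ltW.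
Qed.

(** The reverse triangle inequality between the l^2 norms of [sqrt F] and
    [sqrt G]. *)
Lemma sqrt_sum_contraction (T : finType) (x0 : T) (F G : T -> R) :
  (forall x, 0 < F x) -> (forall x, 0 < G x) ->
  (Num.sqrt (\sum_x F x) - Num.sqrt (\sum_x G x)) ^+ 2 <=
  \sum_x (Num.sqrt (F x) - Num.sqrt (G x)) ^+ 2.
Proof.
move=> F0 G0; have SF := psum_gt0 x0 F0; have SG := psum_gt0 x0 G0.
set p := Num.sqrt (\sum_x F x); set q := Num.sqrt (\sum_x G x).
have p0 : 0 < p by rewrite sqrtr_gt0.
have q0 : 0 < q by rewrite sqrtr_gt0.
have pE : \sum_x F x = p ^+ 2 by rewrite sqr_sqrtr// ltW.
have qE : \sum_x G x = q ^+ 2 by rewrite sqr_sqrtr// ltW.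
(* The weights make the sum over [x] of the left-hand sides equal to
   [(p - q) ^+ 2]. *)
have H x : F x * (1 - q / p) + G x * (1 - p / q) <=
    (Num.sqrt (F x) - Num.sqrt (G x)) ^+ 2.
  rewrite -[F x in leLHS](sqr_sqrtr (ltW (F0 x))) -[G x in leLHS](sqr_sqrtr (ltW (G0 x))).
  set s := Num.sqrt (F x); set t := Num.sqrt (G x).
  rewrite -subr_ge0.
  have -> : (s - t) ^+ 2 - (s ^+ 2 * (1 - q / p) + t ^+ 2 * (1 - p / q)) =
      (s * q - t * p) ^+ 2 / (p * q) by field; rewrite !gt_eqF.
  by rewrite divr_ge0 ?sqr_ge0// mulr_ge0// ltW.
apply: le_trans (ler_sum _ (fun x _ => H x)).
rewrite big_split/= -!mulr_suml pE qE.
by rewrite le_eqVlt; apply/orP; left; apply/eqP; field; rewrite !gt_eqF.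
Qed.

(** Induction on the dimension: both the entropy and the energy split along the
    first coordinate into those of the two restrictions and those of the pair of
    their masses, exactly for the entropy, and up to [sqrt_sum_contraction] for
    the energy. *)
Lemma tensorization (a b : R) :
  (forall A B, 0 < A -> 0 < B ->
    a * (A * ln A + B * ln B - (A + B) * (ln (A + B) - ln 2)) - b * (A + B) <=
    2 * (Num.sqrt A - Num.sqrt B) ^+ 2) ->
  forall n (F : cube n -> R), (forall x, 0 < F x) ->
    a * entropy F - n%:R * b * \sum_x F x <= energy F.
Proof.
move=> H; elim=> [F F0|n IH F F0].
  have c0 x : x = [ffun=> true] :> cube 0 by apply/ffunP => -[].
  rewrite /entropy /energy.
  have E (G : cube 0 -> R) : \sum_x G x = G [ffun=> true].
    by rewrite (bigD1 [ffun=> true])//= big_pred0 ?addr0// => x; rewrite [x]c0 eqxx.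
  by rewrite !E big_ord0 !mul0r subr0 subr0 subrr mulr0.
pose G b (x : cube n) := F (cube_cons b x).
have G0 c x : 0 < G c x by exact: F0.
have S0 c : 0 < \sum_x G c x by apply: (psum_gt0 [ffun=> true]).
have sumE (K : cube n.+1 -> R) : \sum_x K x =
    \sum_x K (cube_cons true x) + \sum_x K (cube_cons false x).
  by rewrite sum_cubeS big_bool.
have entE : entropy F = entropy (G true) + entropy (G false) +
    ((\sum_x G true x) * ln (\sum_x G true x) +
     (\sum_x G false x) * ln (\sum_x G false x) -
     (\sum_x G true x + \sum_x G false x) *
       (ln (\sum_x G true x + \sum_x G false x) - ln 2)).
  rewrite /entropy !sumE -[n.+1]addn1 natrD.
  rewrite -/(\sum_x G true x * ln (G true x)) -/(\sum_x G false x * ln (G false x)).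
  rewrite -/(\sum_x G true x) -/(\sum_x G false x).
  by ring.
have enE : energy F = energy (G true) + energy (G false) +
    2 * \sum_x (Num.sqrt (G true x) - Num.sqrt (G false x)) ^+ 2.
  have E c : \sum_x \sum_i (Num.sqrt (F (cube_cons c x)) -
        Num.sqrt (F (flip i (cube_cons c x)))) ^+ 2 =
      energy (G c) + \sum_x (Num.sqrt (G true x) - Num.sqrt (G false x)) ^+ 2.
    rewrite /energy -big_split/=; apply: eq_bigr => x _.
    rewrite big_ord_recl [RHS]addrC flip_cons0; congr (_ + _).
      by case: c; rewrite /G//= -sqrrN opprB.
    by apply: eq_bigr => i _; rewrite flip_consS.
  by rewrite {1}/energy sumE !E; ring.
rewrite entE enE (sumE F).
have := H _ _ (S0 true) (S0 false).
have := sqrt_sum_contraction [ffun=> true] (G0 true) (G0 false).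
have := IH _ (G0 true); have := IH _ (G0 false).
rewrite -[n.+1]addn1 natrD.
set e1 := entropy (G true); set e2 := entropy (G false).
set n1 := energy (G true); set n2 := energy (G false).
set s1 := \sum_x G true x; set s2 := \sum_x G false x.
set q := (Num.sqrt s1 - _) ^+ 2; set r := \sum_x (_ - _) ^+ 2.
set e := (s1 * _ + _ - _) => h1 h2 h3 h4.
have -> : a * (e1 + e2 + e) - (n%:R + 1) * b * (s1 + s2) =
  (a * e1 - n%:R * b * s1) + (a * e2 - n%:R * b * s2) +
  (a * e - b * (s1 + s2)) by ring.
by lra.
Qed.

(** The tangent at [rho] to the two-point profile is an affine inequality, which
    tensorizes; where the entropy is at least [n rho], the chord
    from the origin lies below the tangent. *)
Lemma log_sobolev_cube n (F : cube n -> R) (rho : R) :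
  0 <= rho < ln 2 -> (forall x, 0 < F x) ->
  n%:R * rho * \sum_x F x <= entropy F -> C_LSI rho * entropy F <= energy F.
Proof.
move=> rho2 F0 HF.
have [a [b [E /andP[Ca _] tan]]] := C_LSI_tangent rho2.
have : a * entropy F - n%:R * b * \sum_x F x <= energy F.
  apply: tensorization => // A B A0 B0.
  have AB : 0 < A + B by rewrite addr_gt0.
  have y01 : 0 < A / (A + B) < 1.
    by rewrite divr_gt0//= ltr_pdivrMr// mul1r ltrDl.
  have yB : 1 - A / (A + B) = B / (A + B) by field; rewrite gt_eqF.
  have := tan _ y01; rewrite /deficit /bit_energy /binent yB.
  rewrite !ln_div ?posrE//.
  have -> : A / (A + B) * (B / (A + B)) = A * B / (A + B) ^+ 2.
    by field; rewrite gt_eqF.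
  have A1 := ltW A0; have B1 := ltW B0.
  rewrite sqrtrM ?mulr_ge0// sqrtrM// sqrtrV ?sqr_ge0// sqrtr_sqr gtr0_norm//.
  rewrite -(ler_pM2r AB) => /le_trans h.
  have -> : a * (A * ln A + B * ln B - (A + B) * (ln (A + B) - ln 2)) - b * (A + B)
    = (a * (ln 2 - (- (A / (A + B) * (ln A - ln (A + B))) -
       B / (A + B) * (ln B - ln (A + B)))) - b) * (A + B).
    by field; rewrite gt_eqF.
  apply: h; rewrite le_eqVlt; apply/orP; left; apply/eqP.
  rewrite sqrrB !sqr_sqrtr//.
  by field; rewrite gt_eqF.
apply: le_trans; rewrite -subr_ge0.
have -> : a * entropy F - n%:R * b * (\sum_x F x) - C_LSI rho * entropy F =
  (a - C_LSI rho) * (entropy F - n%:R * rho * \sum_x F x)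
  + n%:R * (\sum_x F x) * (a * rho - b - C_LSI rho * rho) by ring.
by rewrite E subrr mulr0 addr0 mulr_ge0// subr_ge0.
Qed.

End Tensorization.

(** * The semigroup on the cube *)

Section Heat.
Variable R : realType.
Local Open Scope classical_set_scope.
Local Open Scope ring_scope.

Definition bit_kernel (t : R) (c b : bool) : R := T_bit t (fun z => (z == c)%:R) b.

Definition heat n (f : cube n -> R) (t : R) (x : cube n) : R :=
  tensor_power (T_bit t) f x.

Lemma heatE n (f : cube n -> R) t x :
  heat f t x = \sum_y f y * \prod_i bit_kernel t (y i) (x i).
Proof. by []. Qed.

Lemma bit_kernelE (t : R) c b :
  bit_kernel t c b = (if b == c then 1 + expR (- t) else 1 - expR (- t)) / 2.
Proof.
rewrite /bit_kernel /T_bit.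
by case: b; case: c; rewrite /= ?(mul1r, mul0r, add0r, addr0).
Qed.

Lemma bit_kernel_gt0 t c b : 0 < t -> 0 < bit_kernel t c b.
Proof.
move=> t0; rewrite bit_kernelE divr_gt0//.
case: ifP => _; first by rewrite addr_gt0// expR_gt0.
by rewrite subr_gt0 expR_lt1 oppr_lt0.
Qed.

Lemma bit_kernel_sum t c : \sum_b bit_kernel t c b = 1.
Proof. by rewrite big_bool/= !bit_kernelE; case: c => /=; field. Qed.

Lemma bit_kernel0 c b : bit_kernel 0 c b = (b == c)%:R.
Proof. by rewrite bit_kernelE oppr0 expR0; case: eqP => _ /=; field. Qed.

Lemma is_derive_bit_kernel (t : R) c b :
  is_derive t 1 (fun s => bit_kernel s c b)
    ((bit_kernel t c (~~ b) - bit_kernel t c b) / 2).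
Proof.
have de : is_derive t 1 (fun s : R => expR (- s)) (- expR (- t)).
  apply: (is_derive_eq (is_derive_expR1 (is_deriveN1 (is_derive_id t (1 : R))))).
  by rewrite mulrN1.
under eq_fun do rewrite bit_kernelE.
rewrite !bit_kernelE.
have d1 := is_derive_cst (1 : R) t (1 : R).
case: b c => -[] /=.
- by apply: (is_derive_eq (is_deriveMr1 2^-1 (is_deriveD1 d1 de))); field.
- by apply: (is_derive_eq (is_deriveMr1 2^-1 (is_deriveB1 d1 de))); field.
- by apply: (is_derive_eq (is_deriveMr1 2^-1 (is_deriveB1 d1 de))); field.
- by apply: (is_derive_eq (is_deriveMr1 2^-1 (is_deriveD1 d1 de))); field.
Qed.

Variable n : nat.
Implicit Types (f : cube n -> R) (t : R) (x y : cube n).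

Lemma heat_mass f t : \sum_x heat f t x = \sum_x f x.
Proof.
rewrite exchange_big/=; apply: eq_bigr => y _; rewrite -mulr_sumr.
rewrite -(bigA_distr_bigA (fun i b => bit_kernel t (y i) b)).
by rewrite big1 ?mulr1// => i _; exact: bit_kernel_sum.
Qed.

Lemma heat0 f x : heat f 0 x = f x.
Proof.
rewrite heatE (bigD1 x)//= big1 => [|i _]; last first.
  by rewrite bit_kernel0 eqxx.
rewrite mulr1 big1 ?addr0// => y yx.
have /existsP[i xyi] : [exists i, x i != y i].
  apply: contraNT yx; rewrite negb_exists => /forallP H.
  by apply/eqP/ffunP => i; have := H i; rewrite negbK => /eqP.
by rewrite (bigD1 i)//= bit_kernel0 (negPf xyi) mul0r mulr0.
Qed.

Lemma heat_gt0 f t x : (forall y, 0 <= f y) -> 0 < \sum_y f y -> 0 < t ->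
  0 < heat f t x.
Proof.
move=> f0 sf t0; rewrite heatE.
have k0 y : 0 < \prod_i bit_kernel t (y i) (x i).
  by apply: prodr_gt0 => i _; exact: bit_kernel_gt0.
rewrite lt_neqAle sumr_ge0 ?andbT => [|y _]; last by rewrite mulr_ge0// ltW.
apply/eqP => /esym/eqP; rewrite psumr_eq0 => [|y _]; last by rewrite mulr_ge0// ltW.
move=> /allP H; move: sf; rewrite big1 ?ltxx// => y _.
have := H y; rewrite mem_index_enum mulf_eq0 (gt_eqF (k0 y)) orbF => /(_ isT).
by move/eqP.
Qed.

Lemma is_derive_heat f t x : 0 < t ->
  is_derive t 1 (fun s => heat f s x)
    (\sum_i (heat f t (flip i x) - heat f t x) / 2).
Proof.
move=> t0; under eq_fun do rewrite heatE.
pose k y i := bit_kernel t (y i) (x i); pose k' (y : cube n) i := bit_kernel t (y i) (~~ x i).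
have k0 (y : cube n) i : k y i != 0 by rewrite gt_eqF// bit_kernel_gt0.
have kflip i y : \prod_j bit_kernel t (y j) (flip i x j) = k' y i / k y i * \prod_j k y j.
  rewrite [LHS](bigD1 i)//= [in RHS](bigD1 i)//= ffunE eqxx mulrA divfK//.
  by congr (_ * _); apply: eq_bigr => j ji; rewrite ffunE (negPf ji).
have d y : is_derive t 1 (fun s => f y * \prod_i bit_kernel s (y i) (x i))
    (f y * ((\sum_i (k' y i - k y i) / 2 / k y i) * \prod_i k y i)).
  apply: is_deriveMl1; apply: is_derive_prod1 => [i|i]; first exact: k0.
  exact: is_derive_bit_kernel.
apply: (is_derive_eq (is_derive_sum1 _ _ d)).
under [RHS]eq_bigr do rewrite !heatE -sumrB mulr_suml.
rewrite [RHS]exchange_big/=; apply: eq_bigr => y _.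
rewrite mulr_suml mulr_sumr; apply: eq_bigr => i _.
by rewrite kflip -/(k y _); field; rewrite k0.
Qed.

Lemma continuous_heat f x : continuous (fun t => heat f t x).
Proof.
move=> t; rewrite /continuous_at.
under eq_cvg do rewrite heatE.
rewrite heatE; apply: cvg_big => [|y _].
- exact: add_continuous.
- apply: cvgMr; apply: cvg_big => [|i _]; first exact: mul_continuous.
  exact: (is_derive_continuous (is_derive_bit_kernel t (y i) (x i))).
Qed.

End Heat.

(** * Monotonicity of the norms along the semigroup *)

Section Inequalities.
Variables (R : realType) (n : nat).
Implicit Types (h g : cube n -> R) (p : R).

(** Summation by parts: each edge of the cube is counted from its two ends. *)
Lemma heat_by_parts g h :
  \sum_x g x * (\sum_i (h (flip i x) - h x) / 2) =
  - 4^-1 * \sum_x \sum_i (g x - g (flip i x)) * (h x - h (flip i x)).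
Proof.
under eq_bigr do rewrite mulr_sumr.
rewrite exchange_big [in RHS]exchange_big/= mulr_sumr; apply: eq_bigr => i _.
have E : \sum_x (g x - g (flip i x)) * (h x - h (flip i x)) =
    \sum_x - (2 * g x * (h (flip i x) - h x)).
  transitivity (\sum_x (g x * (h x - h (flip i x)) - g (flip i x) * (h x - h (flip i x)))).
    by apply: eq_bigr => x _; rewrite mulrBl.
  rewrite sumrB -[X in _ - X](sum_flip i) -sumrB; apply: eq_bigr => x _.
  by rewrite flipK; ring.
by rewrite E mulr_sumr; apply: eq_bigr => x _; field.
Qed.

(** [stroock_varopoulos] on every edge of the cube, with [x] and [y] the values
    of [ln h] at its ends. *)
Lemma energy_pow_le p h : 1 < p -> (forall x, 0 < h x) ->
  p ^+ 2 * \sum_x expR (p * ln (h x)) * ((\sum_i (h (flip i x) - h x) / 2) / h x) <=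
  - (p - 1) * energy (fun x => expR (p * ln (h x))).
Proof.
move=> p1 h0.
have -> : \sum_x expR (p * ln (h x)) * ((\sum_i (h (flip i x) - h x) / 2) / h x) =
    \sum_x expR ((p - 1) * ln (h x)) * (\sum_i (h (flip i x) - h x) / 2).
  apply: eq_bigr => x _; rewrite mulrBl mul1r expRB lnK ?posrE//.
  by rewrite [RHS]mulrAC -mulrA.
rewrite heat_by_parts mulrCA !mulNr lerN2 ler_pdivlMl// /energy mulrCA !mulr_sumr.
apply: ler_sum => x _; rewrite !mulr_sumr; apply: ler_sum => i _.
rewrite !sqrt_expR [leRHS]mulrCA [_ * (h x - _)]mulrC.
have := @stroock_varopoulos _ p (ln (h x)) (ln (h (flip i x))) (ltW p1).
by rewrite !lnK ?posrE//; lra.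
Qed.

(** Jensen's inequality for the logarithm of [h `^ (1 - p)] under the
    probability of density proportional to [h `^ p]. *)
Lemma sum_pow_ln_ge p h (x0 : cube n) : (forall x, 0 < h x) ->
  (\sum_x expR (p * ln (h x))) *
    (ln (\sum_x expR (p * ln (h x))) - ln (\sum_x h x)) <=
  (p - 1) * \sum_x expR (p * ln (h x)) * ln (h x).
Proof.
move=> h0; set S := \sum_x expR _; set m := \sum_x h x.
have m0 : 0 < m by apply: (psum_gt0 x0).
have S0 : 0 < S by apply: (psum_gt0 x0) => x; exact: expR_gt0.
have H x : expR (p * ln (h x)) * (ln S - ln m - (p - 1) * ln (h x)) <=
    h x * S / m - expR (p * ln (h x)).
  have -> : h x = expR (ln (h x)) by rewrite lnK ?posrE.
  have -> : ln S - ln m - (p - 1) * ln (expR (ln (h x))) =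
      ln (S / m * expR ((1 - p) * ln (h x))).
    by rewrite lnM ?posrE ?divr_gt0 ?expR_gt0// ln_div ?posrE// !expRK; ring.
  rewrite expRK; set z := S / m * _.
  have z0 : 0 < z by rewrite mulr_gt0 ?divr_gt0 ?expR_gt0.
  have lz : ln z <= z - 1 by have := @le_ln1Dx _ (z - 1); rewrite subrKC; apply; lra.
  apply: (le_trans (ler_wpM2l (expR_ge0 _) lz)).
  rewrite le_eqVlt; apply/orP; left; apply/eqP; rewrite /z mulrBr mulr1; congr (_ - _).
  by rewrite mulrCA -expRD -mulrDl subrKC mul1r; field; rewrite gt_eqF.
have : \sum_x expR (p * ln (h x)) * (ln S - ln m - (p - 1) * ln (h x)) <=
    \sum_x (h x * S / m - expR (p * ln (h x))).
  by apply: ler_sum => x _; exact: H.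
rewrite [leRHS]sumrB -!mulr_suml -/m -/S.
have -> : m * S / m = S by field; rewrite gt_eqF.
rewrite subrr.
under eq_bigr do rewrite mulrBr.
rewrite sumrB -mulr_suml -/S subr_le0 => /le_trans; apply.
rewrite mulr_sumr le_eqVlt; apply/orP; left; apply/eqP.
by apply: eq_bigr => x _; ring.
Qed.

(** The hypothesis is the logarithm of [||h||_p >= e^(n rho0) ||h||_1]. The
    logarithm of the sum of [h `^ p] is convex in [p], and [sum_pow_ln_ge]
    compares its increment between 1 and [p] with its derivative at [p], in which
    the entropy appears. *)
Lemma entropy_pow_ge p h (x0 : cube n) (rho0 : R) : 1 < p -> (forall x, 0 < h x) ->
  let F := fun x => expR (p * ln (h x)) in
  p * (n%:R * rho0 + (ln (\sum_x h x) - n%:R * ln 2)) <= ln (\sum_x F x) - n%:R * ln 2 ->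
  n%:R * (rho0 * (p / (p - 1))) * \sum_x F x <= entropy F.
Proof.
move=> p1 h0 F H.
have S0 : 0 < \sum_x F x by apply: (psum_gt0 x0) => x; exact: expR_gt0.
have p10 : 0 < p - 1 by rewrite subr_gt0.
have := @sum_pow_ln_ge p h x0 h0; rewrite /= -/F.
have -> : entropy F = p * (\sum_x F x * ln (h x)) -
    (\sum_x F x) * (ln (\sum_x F x) - n%:R * ln 2).
  rewrite /entropy mulr_sumr; congr (_ - _); apply: eq_bigr => x _.
  by rewrite /F expRK mulrCA.
set S := \sum_x F x in S0 H *; set m := \sum_x h x in H *.
set J := \sum_x F x * _ => HJ.
rewrite -(ler_pM2r p10).
have -> : n%:R * (rho0 * (p / (p - 1))) * S * (p - 1) = S * (p * (n%:R * rho0)).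
  by field; rewrite gt_eqF.
have HS : S * (p * (n%:R * rho0 + (ln m - n%:R * ln 2))) <= S * (ln S - n%:R * ln 2).
  by rewrite ler_pM2l.
have p0 : 0 <= p by lra.
have := ler_wpM2l p0 HJ.
by lra.
Qed.

End Inequalities.

Section Monotonicity.
Variable R : realType.
Local Open Scope classical_set_scope.
Local Open Scope ring_scope.

(** After the last time at which [f <= c], the function stays above [c], hence
    does not increase. *)
Lemma barrier (f df : R -> R) (c T : R) : 0 <= T ->
  {within `[0, T], continuous f} ->
  (forall t : R, 0 < t < T -> is_derive t 1 f (df t)) ->
  (forall t : R, 0 < t < T -> c < f t -> df t <= 0) ->
  f 0 <= c -> f T <= c.
Proof.
move=> T0 cf df' df0 f0; rewrite leNgt; apply/negP => fT.
pose A := [set t : R | 0 <= t <= T /\ f t <= c].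
have supA : has_sup A.
  by split; [exists 0; rewrite /A/= lexx|exists T => t [/andP[]]].
have A0 : A 0 by rewrite /A/= lexx.
set s := sup A.
have s0 : 0 <= s by apply: ub_le_sup => //; case: supA.
have sT : s <= T by apply: ge_sup => [|t [/andP[]]//]; exists 0.
have fs : f s <= c.
  rewrite leNgt; apply/negP => cs.
  move/subspace_continuousP : cf => /(_ s); rewrite /= in_itv/= s0 sT => /(_ isT) cfs.
  have /nbhs_ballP[d /= d0 sd] : \forall t \near s, `[0, T]%classic t -> c < f t.
    exact: (cvgr_gt _ cfs _ cs).
  have [t At st] := sup_adherent d0 supA.
  have ts : t <= s by apply: ub_le_sup => //; case: supA.
  case: At => tT ft; have := sd t.
  rewrite /ball/= ger0_norm ?subr_ge0// ltrBlDl -ltrBlDr => /(_ st).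
  by rewrite in_itv/= tT => /(_ isT); rewrite ltNge ft.
have sltT : s < T.
  by rewrite lt_neqAle sT andbT; apply/eqP => sTE; move: fT; rewrite ltNge -sTE fs.
suff : f T <= f s by rewrite leNgt (le_lt_trans fs fT).
apply: (@is_derive_le0_ge _ f df _ _ sT).
- apply: continuous_subspaceW cf => t; rewrite /= !in_itv/= => /andP[st ->].
  by rewrite (le_trans s0 st).
- by move=> t /andP[st tT]; apply: df'; rewrite (le_lt_trans s0 st).
- move=> t /andP[st tT]; apply: df0; first by rewrite (le_lt_trans s0 st).
  rewrite ltNge; apply/negP => ft; move: (st); rewrite ltNge => /negP; apply.
  apply: ub_le_sup; first by case: supA.
  by split=> //; rewrite (ltW tT) andbT (le_trans s0 (ltW st)).
Qed.

(** The point is the case [a0 = 0], where [ln] is discontinuous: there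
    [a `^ p <= a] as soon as [a <= 1]. *)
Lemma cvg_powR (T : Type) (F : set_system T) {FF : Filter F} (a p : T -> R) (a0 p0 : R) :
  a t @[t --> F] --> a0 -> p t @[t --> F] --> p0 ->
  (\forall t \near F, 0 <= a t) -> (\forall t \near F, 1 <= p t) ->
  0 <= a0 -> 1 <= p0 -> a t `^ p t @[t --> F] --> a0 `^ p0.
Proof.
move=> ca cp a_ge0 p_ge1 a00 p01.
move: a00; rewrite le_eqVlt => /predU1P[a00|a00].
  rewrite -a00 powR0 ?gt_eqF ?(lt_le_trans ltr01)//.
  rewrite -a00 in ca.
  apply: (squeeze_cvgr _ (cvg_cst (0 : R)) ca).
  have a1 : \forall t \near F, a t < 1 by exact: (cvgr_lt _ ca).
  near=> t; rewrite powR_ge0/=.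
  have : 0 <= a t by near: t.
  have p1 : 1 <= p t by near: t.
  rewrite le_eqVlt => /predU1P[<-|at0].
    by rewrite powR0// gt_eqF// (lt_le_trans ltr01).
  by apply: ge1r_powR => //; rewrite at0 ltW//; near: t.
have powE (b q : R) : 0 < b -> b `^ q = expR (q * ln b).
  by move=> b0; rewrite /powR gt_eqF.
rewrite powE//.
have cl : ln (a t) @[t --> F] --> ln a0.
  exact: (cvg_comp _ _ ca (continuous_ln a00)).
have cpl : p t * ln (a t) @[t --> F] --> p0 * ln a0 by exact: cvgM.
have : expR (p t * ln (a t)) @[t --> F] --> expR (p0 * ln a0).
  exact: (cvg_comp _ _ cpl (@continuous_expR R _)).
apply: cvg_trans; apply: near_eq_cvg.
have : \forall t \near F, 0 < a t by exact: (cvgr_gt _ ca).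
by apply: filterS => t at0; rewrite powE.
Unshelve. all: by end_near. Qed.

End Monotonicity.

(** * Hypercontractivity along the differential equation *)

Section Hypercontractivity.
Variable R : realType.
Local Open Scope classical_set_scope.
Local Open Scope ring_scope.

Lemma norm_cubeE n (q : R) (f : cube n -> R) : (forall x, 0 <= f x) ->
  0 < \sum_x f x `^ q ->
  norm_cube q f = expR (q^-1 * (ln (\sum_x f x `^ q) - n%:R * ln 2)).
Proof.
move=> f0 S0; rewrite /norm_cube /expectation_cube.
under eq_bigr do rewrite ger0_norm//.
rewrite /powR gt_eqF ?mulr_gt0 ?invr_gt0 ?exprn_gt0//; congr expR.
by rewrite lnM ?posrE ?invr_gt0 ?exprn_gt0// lnV ?posrE ?exprn_gt0// lnXn// mulr_natl addrC.
Qed.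

Lemma powR_expR (a q : R) : 0 < a -> a `^ q = expR (q * ln a).
Proof. by move=> a0; rewrite /powR gt_eqF. Qed.

Variables (n : nat) (rho0 : R) (u : R -> R) (f : cube n -> R).
Let p (t : R) := 1 + expR (u t).
Let S (t : R) := \sum_x heat f t x `^ p t.
Let phi (t : R) := (p t)^-1 * (ln (S t) - n%:R * ln 2).
Let rho (t : R) := rho0 * (1 + expR (- u t)).

Hypothesis f0 : forall x, 0 <= f x.
Hypothesis fS : 0 < \sum_x f x.
Hypothesis du : forall t : R, 0 < t -> is_derive t 1 u (C_LSI (rho t)).
Hypothesis cu : u t @[t --> 0^'+] --> u 0.
Hypothesis rho_lt : forall t : R, 0 < t -> 0 <= rho t < ln 2.

Let p_gt1 t : 1 < p t.
Proof. by rewrite ltrDl expR_gt0. Qed.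

Let p_gt0 t : 0 < p t.
Proof. exact: lt_trans (p_gt1 t). Qed.

Let S_gt0 t : 0 <= t -> 0 < S t.
Proof.
rewrite le_eqVlt => /predU1P[<-|t0]; last first.
  by apply: (psum_gt0 [ffun=> true]) => x; rewrite powR_gt0// heat_gt0.
rewrite lt_neqAle sumr_ge0 ?andbT => [|x _]; last exact: powR_ge0.
apply/eqP => /esym/eqP; rewrite psumr_eq0 => [/allP H|x _]; last exact: powR_ge0.
move: fS; rewrite big1 ?ltxx// => x _; have := H x.
by rewrite mem_index_enum => /(_ isT)/eqP/powR_eq0_eq0; rewrite heat0.
Qed.

Let F t (x : cube n) := expR (p t * ln (heat f t x)).

Let dS t : R := \sum_x F t x *
  (expR (u t) * C_LSI (rho t) * ln (heat f t x) +
   p t * ((\sum_i (heat f t (flip i x) - heat f t x) / 2) / heat f t x)).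

Let dphi t : R := - (expR (u t) * C_LSI (rho t)) / p t ^+ 2 * (ln (S t) - n%:R * ln 2)
  + (p t)^-1 * (dS t / S t).

Let SE t : 0 < t -> S t = \sum_x F t x.
Proof. by move=> t0; apply: eq_bigr => x _; rewrite powR_expR// heat_gt0. Qed.

Let is_derive_p (t : R) : 0 < t -> is_derive t 1 p (expR (u t) * C_LSI (rho t)).
Proof.
move=> t0; have d1 := is_derive_cst (1 : R) t (1 : R).
by apply: (is_derive_eq (is_deriveD1 d1 (is_derive_expR1 (du t0)))); rewrite add0r.
Qed.

Let is_derive_S (t : R) : 0 < t -> is_derive t 1 S (dS t).
Proof.
move=> t0; apply: (@near_eq_is_derive _ _ _ (fun s => \sum_x F s x)).
  by near=> s; rewrite SE//; near: s; exact: lt_nbhsr.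
apply: is_derive_sum1 => x; apply: is_derive_expR1.
have h0 : 0 < heat f t x by exact: heat_gt0.
have dl := is_derive_ln1 h0 (is_derive_heat f x t0).
exact: is_deriveM1 (is_derive_p t0) dl.
Unshelve. all: by end_near. Qed.

Let is_derive_phi (t : R) : 0 < t -> is_derive t 1 phi (dphi t).
Proof.
move=> t0; apply: is_deriveM1.
  by apply: is_deriveV1; [rewrite gt_eqF|exact: is_derive_p].
have dc := is_derive_cst (n%:R * ln 2 : R) t (1 : R).
have dl := is_derive_ln1 (S_gt0 (ltW t0)) (is_derive_S t0).
by apply: (is_derive_eq (is_deriveB1 dl dc)); rewrite subr0.
Qed.

(** Where the norm is large the entropy is large, so [log_sobolev_cube] applies
    with the coefficient [C_LSI (rho t)] that drives the exponent. *)
Let dphi_le0 (t : R) : 0 < t ->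
  n%:R * rho0 + (ln (\sum_x f x) - n%:R * ln 2) <= phi t -> dphi t <= 0.
Proof.
move=> t0 Hphi; have h0 x : 0 < heat f t x by exact: heat_gt0.
have F0 x : 0 < F t x by exact: expR_gt0.
have S0 := S_gt0 (ltW t0).
have ent : n%:R * rho t * \sum_x F t x <= entropy (F t).
  have -> : rho t = rho0 * (p t / (p t - 1)).
    rewrite /rho /p addrAC subrr add0r expRN; congr (_ * _).
    by field; rewrite gt_eqF// expR_gt0.
  apply: (entropy_pow_ge [ffun=> true]) => //.
  by rewrite heat_mass -SE// -ler_pdivlMl.
have lsi := log_sobolev_cube (rho_lt t0) F0 ent.
have := energy_pow_le (p_gt1 t) h0; rewrite -/(F t).
set V := \sum_x _ => HV.
set W := \sum_x F t x * ln (heat f t x).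
have entE : entropy (F t) = p t * W - S t * (ln (S t) - n%:R * ln 2).
  rewrite /entropy -SE// /W mulr_sumr; congr (_ - _); apply: eq_bigr => x _.
  by rewrite {2}/F expRK mulrCA.
have dSE : dS t = expR (u t) * C_LSI (rho t) * W + p t * V.
  rewrite /W /V !mulr_sumr -big_split/=; apply: eq_bigr => x _.
  by rewrite mulrDr; congr (_ + _); rewrite mulrCA.
have k0 : 0 < p t ^+ 2 * S t by rewrite mulr_gt0// exprn_gt0.
rewrite -(ler_pM2l k0) mulr0.
have -> : p t ^+ 2 * S t * dphi t =
    expR (u t) * C_LSI (rho t) * entropy (F t) + p t ^+ 2 * V.
  rewrite /dphi dSE entE; field.
  by rewrite !gt_eqF.
have pu : p t - 1 = expR (u t) by rewrite /p addrAC subrr add0r.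
rewrite pu in HV.
have := ler_wpM2l (expR_ge0 (u t)) lsi.
by rewrite mulrA; lra.
Qed.

Let within_phi (T : R) : {within `[0, T], continuous phi}.
Proof.
apply: within_right_continuous => [|t /andP[t0 _]]; last first.
  exact: (is_derive_continuous (is_derive_phi t0)).
have cp : p t @[t --> 0^'+] --> p 0.
  apply: cvgD; first exact: cvg_cst.
  exact: (cvg_comp _ _ cu (@continuous_expR R _)).
have cS : S t @[t --> 0^'+] --> S 0.
  apply: cvg_big => [|x _]; first exact: add_continuous.
  apply: cvg_powR => //.
  - by apply: cvg_at_right_filter; exact: continuous_heat.
  - near=> t; apply/ltW/heat_gt0 => //.
  - by near=> t; exact: ltW.
  - by rewrite heat0.
  - exact: ltW.
apply: cvgM.
  by apply: cvgV; [rewrite gt_eqF|].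
apply: cvgB; last exact: cvg_cst.
exact: (cvg_comp _ _ cS (continuous_ln (S_gt0 (lexx 0)))).
Unshelve. all: by end_near. Qed.

Lemma heat_norm_le :
  expR (n%:R * rho0) * norm_cube 1 f <= norm_cube (p 0) f ->
  forall t : R, 0 <= t -> norm_cube (p t) (heat f t) <= norm_cube (p 0) f.
Proof.
move=> H t t0.
have h_ge0 x : 0 <= heat f t x.
  by move: t0; rewrite le_eqVlt => /predU1P[<-|/heat_gt0 h]; rewrite ?heat0// ltW// h.
have S00 : S 0 = \sum_x f x `^ p 0 by apply: eq_bigr => x _; rewrite heat0.
have S0 := S_gt0 (lexx 0); rewrite S00 in S0.
have p0E : norm_cube (p 0) f = expR (phi 0) by rewrite /phi S00 (norm_cubeE f0 S0).
rewrite p0E (norm_cubeE h_ge0 (S_gt0 t0)) ler_expR -/(S t) -/(phi t).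
have f1 : \sum_x f x `^ 1 = \sum_x f x.
  by apply: eq_bigr => x _; rewrite powRr1.
have {H} : n%:R * rho0 + (ln (\sum_x f x) - n%:R * ln 2) <= phi 0.
  have f1_gt0 : 0 < \sum_x f x `^ 1 by rewrite f1.
  move: H; rewrite p0E (norm_cubeE f0 f1_gt0) f1 -expRD ler_expR.
  by rewrite invr1 mul1r.
move=> H; apply: (@barrier _ phi dphi (phi 0) t t0 (@within_phi t)).
- by move=> s /andP[s0 _]; exact: is_derive_phi.
- by move=> s /andP[s0 _] sl; exact: dphi_le0 s0 (le_trans H (ltW sl)).
- exact: lexx.
Qed.

End Hypercontractivity.

(** * Well-posedness and conclusion *)

Section Equation.
Variables (R : realType) (rho0 : R).
Local Open Scope classical_set_scope.
Local Open Scope ring_scope.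
Hypothesis rho0_ge0 : 0 <= rho0.

Let rate (s : R) : R := rho0 * (1 + expR (- s)).

(** Clamping the argument of [C_LSI] makes the right-hand side of the equation
    continuous and bounded on the whole line, as [separable_ode] requires. *)
Let drift (s : R) : R := C_LSI (clamp 0 (ln 2) (rate s)).

Let continuous_drift : continuous drift.
Proof.
move=> s; have cr : rate z @[z --> s] --> rate s.
  have de := is_derive_expR1 (is_deriveN1 (is_derive_id s (1 : R))).
  have d1 := is_derive_cst (1 : R) s (1 : R).
  exact: (is_derive_continuous (is_deriveMl1 rho0 (is_deriveD1 d1 de))).
exact: (cvg_comp _ _ cr (@continuous_C_LSI R _)).
Qed.

Let drift_bound : exists M : R, forall s, 2 <= drift s <= M.
Proof.
have l0 := ltW (ln2_gt0 R).
have cC : {within `[0, ln 2], continuous (fun x : R => C_LSI (clamp 0 (ln 2) x))}.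
  by apply: continuous_subspaceT; exact: continuous_C_LSI.
have [c _ cM] := EVT_max l0 cC.
exists (C_LSI (clamp 0 (ln 2) c)) => s; rewrite C_LSI_ge2 ?clamp_itv//=.
have := cM (clamp 0 (ln 2) (rate s)); rewrite in_itv/= clamp_itv// => /(_ isT).
by rewrite [clamp 0 (ln 2) (clamp _ _ _)]clamp_id ?clamp_itv.
Qed.

Let drift_id s : 0 <= rate s <= ln 2 -> drift s = C_LSI (rate s).
Proof. by move=> rs; rewrite /drift clamp_id. Qed.

Let rate_le s0 s : rate s0 <= ln 2 -> s0 <= s -> 0 <= rate s <= ln 2.
Proof.
move=> r0 ss; rewrite mulr_ge0 ?addr_ge0 ?expR_ge0//=.
by apply: le_trans r0; rewrite ler_wpM2l// lerD2l ler_expR lerN2.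
Qed.

Let growth (v : R -> R) (T : R) : 0 <= T -> v t @[t --> 0^'+] --> v 0 ->
  (forall t : R, 0 < t -> is_derive t 1 v (drift (v t))) -> v 0 + 2 * T <= v T.
Proof.
move=> T0 cv dv; have [M fM] := drift_bound.
have dw (t : R) : 0 < t -> is_derive t 1 (fun t => v t - 2 * t) (drift (v t) - 2).
  move=> t0; have d2 := is_deriveMl1 2 (is_derive_id t (1 : R)).
  by apply: (is_derive_eq (is_deriveB1 (dv t t0) d2)); rewrite mulr1.
have cw : {within `[0, T], continuous (fun t => v t - 2 * t)}.
  apply: within_right_continuous => [|t /andP[t0 _]]; last first.
    exact: (is_derive_continuous (dw _ t0)).
  apply: cvgB => //; apply: cvgMr.
  by apply: cvg_at_right_filter; exact: cvg_id.
have : v 0 - 2 * 0 <= v T - 2 * T.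
  apply: (@is_derive_ge0_le _ _ (fun t => drift (v t) - 2) _ _ T0 cw).
    by move=> t /andP[t0 _]; exact: dw.
  by move=> t _; rewrite subr_ge0; case/andP: (fM (v t)).
by rewrite mulr0 subr0; lra.
Qed.

Lemma right_quotient (v : R -> R) (a : R) :
  h^-1 * (v h - v 0) @[h --> 0^'+] --> a -> v h @[h --> 0^'+] --> v 0.
Proof.
move=> cq.
have ch : h @[h --> (0 : R)^'+] --> (0 : R).
  by apply: cvg_at_right_filter; exact: cvg_id.
have : v 0 + h * (h^-1 * (v h - v 0)) @[h --> 0^'+] --> v 0 + 0 * a.
  by apply: cvgD; [exact: cvg_cst|exact: cvgM].
rewrite mul0r addr0; apply: cvg_trans; apply: near_eq_cvg.
near=> h; have h0 : h != 0 by rewrite gt_eqF//; near: h; exact: nbhs_right_gt.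
by rewrite mulVKf// subrKC.
Unshelve. all: by end_near. Qed.

Let is_derive_right_quotient (v : R -> R) (a : R) : is_derive (0 : R) 1 v a ->
  h^-1 * (v h - v 0) @[h --> 0^'+] --> a.
Proof.
move=> [dv <-]; have : h^-1 *: ((v \o shift 0) (h *: 1) - v 0) @[h --> 0^'] --> 'D_1 v (0 : R).
  exact: dv.
move=> /cvg_dnbhs_at_right.
by under eq_fun do rewrite /= addr0 /GRing.scale/= mulr1.
Qed.

(** Along a solution the argument of [C_LSI] decreases, so a solution starting
    in the domain stays there, where clamping changes nothing. The strict growth
    keeps that argument below [ln 2] at positive times. *)
Lemma ode_well_posed (u0 : R) : rho0 * (1 + expR (- u0)) <= ln 2 ->
  exists u : R -> R,
    [/\ ode_solution rho0 u, u 0 = u0,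
        forall v : R -> R, ode_solution rho0 v -> v 0 = u0 ->
          forall t : R, 0 <= t -> v t = u t
      & forall t : R, 0 < t -> u 0 < u t].
Proof.
move=> r0; have [M fM] := drift_bound.
have [u [uu0 du uniq]] := separable_ode u0 continuous_drift (ltr0Sn R 1) fM.
have cu : u t @[t --> 0^'+] --> u 0.
  apply: cvg_at_right_filter.
  exact: (is_derive_continuous (du 0 (lexx 0))).
have du' (t : R) : 0 < t -> is_derive t 1 u (drift (u t)) by move=> /ltW; exact: du.
have ug (t : R) : 0 <= t -> u 0 + 2 * t <= u t by move=> t0; exact: growth.
have ur (t : R) : 0 <= t -> 0 <= rate (u t) <= ln 2.
  move=> t0; apply: (rate_le r0); rewrite -uu0.
  by apply: le_trans (ug _ t0); rewrite lerDl mulr_ge0.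
exists u; split=> //.
- split=> // [t t0|].
    by rewrite -[C_LSI _]drift_id ?ur//; [exact: du'|exact: ltW].
  rewrite -[C_LSI _]drift_id ?ur//.
  exact: (is_derive_right_quotient (du 0 (lexx 0))).
- move=> v [vr dv qv] v0 t t0.
  have cv := right_quotient qv.
  have dv' (s : R) : 0 < s -> is_derive s 1 v (drift (v s)).
    by move=> s0; rewrite drift_id; [exact: dv|apply: vr; exact: ltW].
  apply: uniq => // s s0; rewrite -v0.
  by apply: le_trans (growth s0 cv dv'); rewrite lerDl mulr_ge0.
- by move=> t t0; apply: lt_le_trans (ug _ (ltW t0)); rewrite ltrDl mulr_gt0.
Qed.

End Equation.

Theorem theorem7 (R : realType) (p0 rho0 : R)
    (hp0 : 1 < p0) (hrho0 : 0 <= rho0 <= (1 - p0^-1) * ln 2) :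
  exists u : R -> R,
    [/\ ode_solution rho0 u /\ u 0 = ln (p0 - 1),
        forall v : R -> R, ode_solution rho0 v -> v 0 = ln (p0 - 1) ->
          forall t : R, 0 <= t -> v t = u t
      & forall (n : nat) (f : cube n -> R),
          (0 < n)%N ->
          (forall x, 0 <= f x) ->
          expR (n%:R * rho0) * norm_cube 1 f <= norm_cube p0 f ->
          forall t : R, 0 <= t ->
            norm_cube (1 + expR (u t)) (tensor_power (T_bit t) f)
              <= norm_cube p0 f].
Proof.
have /andP[rho_ge0 rho_le] := hrho0.
have p10 : 0 < p0 - 1 by rewrite subr_gt0.
have p00 : 0 < p0 by apply: lt_trans hp0.
have r0 : rho0 * (1 + expR (- ln (p0 - 1))) <= ln 2.
  rewrite expRN lnK ?posrE//.
  have -> : 1 + (p0 - 1)^-1 = (1 - p0^-1)^-1 by field; rewrite !gt_eqF.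
  have q0 : 0 < 1 - p0^-1 by rewrite subr_gt0 invf_lt1.
  by rewrite ler_pdivrMr// mulrC.
have [u [sol u0 uniq uinc]] := ode_well_posed rho_ge0 r0.
exists u; split; [by split|exact: uniq|move=> n f _ f0 H t t0].
have p0E : 1 + expR (u 0) = p0 by rewrite u0 lnK ?posrE// subrKC.
have : 0 <= \sum_x f x by apply: sumr_ge0.
rewrite le_eqVlt => /predU1P[/esym/eqP|fS].
  rewrite psumr_eq0 => [/allP fz|x _]; last exact: f0.
  have f00 x : f x = 0.
    by have := fz x; rewrite mem_index_enum => /(_ isT)/eqP.
  have q0 : 1 + expR (u t) != 0 by rewrite gt_eqF// addr_gt0// expR_gt0.
  rewrite [leLHS]/norm_cube /expectation_cube big1 => [|x _].
    by rewrite mulr0 powR0 ?invr_neq0//; exact: powR_ge0.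
  rewrite /tensor_power big1 ?normr0 ?powR0// => y _.
  by rewrite f00 mul0r.
have [ur du qu] := sol.
rewrite -p0E in H *.
apply: (@heat_norm_le _ n rho0 u f) => //.
- exact: right_quotient qu.
- move=> s s0; have /andP[-> rs] /= := ur s (ltW s0).
  have [->|rn0] := eqVneq rho0 0; first by rewrite mul0r ln2_gt0.
  have rp : 0 < rho0 by rewrite lt_neqAle eq_sym rn0.
  have /andP[_] := ur 0 (lexx 0); apply: lt_le_trans.
  by rewrite ltr_pM2l// ltrD2l ltr_expR ltrN2 uinc.
Qed.
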